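(* Let $S\in\mathsf{SS}^{\mathrm{ns}}_{\leq n}$. Then the functors $\mathcal R\colon\mathsf{Sh}(S)\to{}^{\mathsf c}_{S}\mathcal M^{\mathsf{DG}}$, $F\mapsto M_F$, and $\mathcal S\colon{}^{\mathsf c}_{S}\mathcal M^{\mathsf{DG}}\to\mathsf{Sh}(S)$, $M\mapsto F_M$, define an equivalence of categories $$\mathsf{Sh}(S)\simeq{}^{\mathsf c}_{S}\mathcal M^{\mathsf{DG}}.$$
   Context: $\Bbbk$ is a field of characteristic different from $2$. **Complexes.** $\mathsf{SS}^{\mathrm{ns}}_{\leq n}$: $n$-truncated semisimplicial sets $S$ (contravariant functors to sets from the category of $[0],\dots,[n]$ with order-preserving injections) such that $\bigsqcup_pS_p$ is finite, every simplex is determined by its ordered tuple of vertices, and every positive-dimensional simplex has pairwise distinct vertices. $[v_0,\dots,v_p]$ denotes the simplex with ordered vertices $v_0,\dots,v_p$; $d_j$ deletes $v_j$; $s([v_0,\dots,v_p])=v_0$. For $\sigma=[v_0,\dots,v_p]$, $\tau=[w_0,\dots,w_q]$, the concatenation $\sigma\star\tau=[v_0,\dots,v_p,w_1,\dots,w_q]$ is *defined* if $v_p=w_0$ and this tuple is the vertex tuple of a simplex in $S_{p+q}$. $P_S=\bigsqcup_pS_p$ is the face poset ($\sigma\le\tau$ iff $\sigma$ is obtained from $\tau$ by a sequence of face maps). $\mathsf{Sh}(S)$ is the category of functors $F\colon P_S\to\mathrm{Vect}_\Bbbk$ (finite-dimensional vector spaces) and natural transformations. **The DGA.** $\Omega_S^p$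 has basis $\{\rho_\sigma\}_{\sigma\in S_p}$; $\Omega_S^0=A_S=\Bbbk(S_0)$ with $\rho_{[v]}=\delta_v$ the indicator functions; $\Omega^p_S=0$ for $p>n$; $\rho_\sigma\wedge\rho_\tau=\rho_{\sigma\star\tau}$ if $\sigma\star\tau$ is defined and $0$ otherwise; $d\rho_\sigma=\sum_{j=0}^{p+1}(-1)^j\sum_{\tau\in S_{p+1},d_j\tau=\sigma}\rho_\tau$. **DG-modules.** ${}_S\mathcal M^{\mathsf{DG}}$ is the category of left DG-modules over $\Omega_S^\bullet$ (graded in degrees $\ge0$, differential $d_M$ of degree $1$ with $d_M^2=0$ and $d_M(\alpha m)=(d\alpha)m+(-1)^{|\alpha|}\alpha\, d_M m$), with degree-$0$ $\Omega_S^\bullet$-linear maps commuting with differentials. $M_v:=\delta_vM$ for $v\in S_0$. A *cellular* DG-module is $M\in{}_S\mathcal M^{\mathsf{DG}}$ with: (S1) for each $0\le q\le n$ a decomposition $M^q=\bigoplus_{\tau\in S_q}M(\tau)$ with each $M(\tau)$ finite-dimensional and $M(\tau)\subseteq M_{s(\tau)}$, and $M^q=0$ for $q>n$; write $\iota_\tau\colon M(\tau)\hookrightarrow M^q$ and $\pi_\tau\colon M^q\twoheadrightarrow M(\tau)$; (S2) with $D_{\tau\to\zeta}:=\pi_\zeta d_M\iota_\tau$ for $\tau\in S_q,\zeta\in S_{q+1}$, one has $d_M|_{M(\tau)}=\sum_{i=0}^{q+1}\sum_{\zeta\in S_{q+1},d_i\zeta=\tau}D_{\tau\to\zeta}$.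 The decomposition is part of the data. A morphism $\phi\colon M\to N$ of ${}_S\mathcal M^{\mathsf{DG}}$ between cellular modules is *cellular* if $\phi(M(\tau))\subseteq N(\tau)$ for all $\tau$. ${}^{\mathsf c}_{S}\mathcal M^{\mathsf{DG}}$ is the category of cellular DG-modules and cellular morphisms. **The functors.** $M_F^q=\bigoplus_{\tau\in S_q}F(\tau)$, with, for $\tau\in S_q$, $x\in F(\tau)$: $\rho_\sigma\cdot x=F(\tau\le\sigma\star\tau)x$ if $\sigma\star\tau$ is defined, else $0$; $d_{M_F}(x)=\sum_{i=0}^{q+1}\sum_{\zeta\in S_{q+1},d_i\zeta=\tau}(-1)^iF(\tau\le\zeta)x$; decomposition $M_F(\tau)=F(\tau)$; $\mathcal R(\eta)=\bigoplus_\tau\eta_\tau$. Conversely $F_M(\tau)=M(\tau)$, $F_M(\tau\le\zeta)=(-1)^iD_{\tau\to\zeta}$ when $d_i\zeta=\tau$, extended to all $\tau\le\xi$ by composing along any maximal chain of codimension-one face inclusions from $\tau$ to $\xi$ (independent of the chain); $\mathcal S(\phi)_\tau=\phi|_{M(\tau)}$. *)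

(* Defs.v *)
From HB Require Import structures.
From mathcomp Require Import all_boot all_order all_algebra.
From mathcomp Require Import boolp zify.
Set Implicit Arguments.
Unset Strict Implicit.
Unset Printing Implicit Defensive.
Import GRing.Theory.
Local Open Scope ring_scope.

Record category := Category {
  ob :> Type;
  hom : ob -> ob -> Type;
  cat_id : forall a, hom a a;
  cat_comp : forall a b c, hom b c -> hom a b -> hom a c;
  _ : forall a b (f : hom a b), cat_comp (cat_id b) f = f;
  _ : forall a b (f : hom a b), cat_comp f (cat_id a) = f;
  _ : forall a b c d (f : hom a b) (g : hom b c) (h : hom c d),
        cat_comp h (cat_comp g f) = cat_comp (cat_comp h g) f
}.

Record functor (C D : category) := Functor {
  fob :> C -> D;
  fhom : forall a b, hom a b -> hom (fob a) (fob b);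
  fhom_id : forall a, fhom (cat_id a) = cat_id (fob a);
  fhom_comp : forall a b c (g : hom b c) (f : hom a b),
    fhom (cat_comp g f) = cat_comp (fhom g) (fhom f)
}.

Definition functor_id (C : category) : functor C C :=
  @Functor C C id (fun _ _ => id) (fun _ => erefl) (fun _ _ _ _ _ => erefl).

Lemma functor_comp_id (C D E : category) (G : functor D E) (F : functor C D)
  (a : C) : fhom G (fhom F (cat_id a)) = cat_id (G (F a)).
Proof. by rewrite !fhom_id. Qed.

Lemma functor_comp_comp (C D E : category) (G : functor D E)
  (F : functor C D) (a b c : C) (g : hom b c) (f : hom a b) :
  fhom G (fhom F (cat_comp g f)) = cat_comp (fhom G (fhom F g)) (fhom G (fhom F f)).
Proof. by rewrite !fhom_comp. Qed.

Definition functor_comp (C D E : category) (G : functor D E) (F : functor C D)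
  : functor C E :=
  @Functor C E (fun a => G (F a)) (fun a b f => fhom G (fhom F f))
    (functor_comp_id G F) (functor_comp_comp G F).

Record nat_iso (C D : category) (F G : functor C D) := NatIso {
  iso_map : forall a : C, hom (F a) (G a);
  iso_inv : forall a : C, hom (G a) (F a);
  _ : forall a, cat_comp (iso_inv a) (iso_map a) = cat_id (F a);
  _ : forall a, cat_comp (iso_map a) (iso_inv a) = cat_id (G a);
  _ : forall a b (f : hom a b),
        cat_comp (iso_map b) (fhom F f) = cat_comp (fhom G f) (iso_map a)
}.

Definition define_equivalence (C D : category)
    (F : functor C D) (G : functor D C) : Prop :=
  inhabited (nat_iso (functor_comp G F) (functor_id C)) /\
  inhabited (nat_iso (functor_comp F G) (functor_id D)).

(** Morphisms [p] -> [q] of the semisimplicial index category. *)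
Record dinj (p q : nat) := DInj {
  dinj_fun :> 'I_p.+1 -> 'I_q.+1;
  dinj_homo : {homo dinj_fun : i j / (i < j)%N}
}.

Lemma dinj_eq p q (f g : dinj p q) : f =1 g -> f = g.
Proof.
case: f g => f hf [g hg] /= /funext e; subst g.
by congr DInj; apply: Prop_irrelevance.
Qed.

Definition dinj_id p : dinj p p := @DInj p p id (fun _ _ => id).

Definition dinj_comp p q r (g : dinj q r) (f : dinj p q) : dinj p r :=
  @DInj p r (g \o f) (fun i j h => dinj_homo g (dinj_homo f h)).

Lemma lift_homo p (j : 'I_p.+2) : {homo lift j : i k / (i < k)%N}.
Proof. by move=> i k ik; rewrite /= ltnNge leq_bump2 -ltnNge. Qed.

Definition coface p (j : 'I_p.+2) : dinj p p.+1 := DInj (lift_homo j).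

Lemma const_homo p (i : 'I_p.+1) :
  {homo (fun _ : 'I_1 => i) : k l / (k < l)%N}.
Proof. by move=> k l; rewrite !ord1. Qed.

Definition covertex p (i : 'I_p.+1) : dinj 0 p := DInj (const_homo i).

(** An [n]-truncated semisimplicial set is represented by its extension by the
    empty set in dimensions above [n]; since the remaining finitely many sets
    are [finType]s, the total set of simplices is finite. *)
Record ssset (n : nat) := SSSet {
  simplex :> nat -> finType;
  pull : forall p q, dinj p q -> simplex q -> simplex p;
  pull_id : forall p (s : simplex p), pull (dinj_id p) s = s;
  pull_comp : forall p q r (g : dinj q r) (f : dinj p q) (s : simplex r),
    pull (dinj_comp g f) s = pull f (pull g s);
  simplex_trunc : forall p, (n < p)%N -> simplex p -> False
}.

Section Simplices.
Variables (n : nat) (X : ssset n).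

Definition face p (j : 'I_p.+2) (s : X p.+1) : X p := pull (coface j) s.

Definition vertex p (s : X p) (i : 'I_p.+1) : X 0%N := pull (covertex i) s.

Definition vertices p (s : X p) : seq (X 0%N) := [seq vertex s i | i : 'I_p.+1].

Definition source p (s : X p) : X 0%N := vertex s ord0.
Definition target p (s : X p) : X 0%N := vertex s ord_max.

Definition nonsingular : Prop :=
  (forall p (s t : X p), vertices s = vertices t -> s = t) /\
  (forall p (s : X p), (0 < p)%N -> injective (vertex s)).

(** [None] when the concatenation is undefined.  In a nonsingular complex at
    most one simplex has the prescribed vertices, so [pick] makes no choice. *)
Definition concat p q (s : X p) (t : X q) : option (X (p + q)%N) :=
  if target s == source t then
    [pick u : X (p + q)%N | vertices u == vertices s ++ behead (vertices t)]
  else None.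

(** Sequences of face maps from [t] down to [s], i.e. maximal chains of
    codimension-one faces between [s] and [t]. *)
Inductive face_chain p (s : X p) : forall q, X q -> Type :=
| FaceChainNil : face_chain s s
| FaceChainStep q (t : X q) (z : X q.+1) (j : 'I_q.+2) :
    face j z = t -> face_chain s t -> face_chain s z.

Definition face_le p q (s : X p) (t : X q) : Prop := inhabited (face_chain s t).

End Simplices.

Arguments FaceChainNil {n X p s}.
Arguments FaceChainStep {n X p s q t z} j _ _.

Record nsset (n : nat) := NSSet {
  nsset_ss :> ssset n;
  nsset_ns : nonsingular nsset_ss
}.

Section Combinatorics.
Variables (n : nat) (X : nsset n).

Lemma vertices_inj p (s t : X p) : vertices s = vertices t -> s = t.
Proof. by case: (nsset_ns X) => + _; apply. Qed.

Lemma vertex_inj p (s : X p) : injective (vertex s).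
Proof.
case: p s => [|p] s; first by move=> i j; rewrite !ord1.
by case: (nsset_ns X) => _; apply.
Qed.

Lemma size_vertices p (s : X p) : size (vertices s) = p.+1.
Proof. by rewrite size_map -cardT card_ord. Qed.

Lemma nth_vertices x0 p (s : X p) (i : 'I_p.+1) :
  nth x0 (vertices s) i = vertex s i.
Proof.
by rewrite (nth_map ord0) ?nth_ord_enum // -cardT card_ord ltn_ord.
Qed.

Lemma vertices_uniq p (s : X p) : uniq (vertices s).
Proof. by rewrite map_inj_uniq ?enum_uniq //; apply: vertex_inj. Qed.

Lemma vertex_pull p q (f : dinj p q) (s : X q) i :
  vertex (pull f s) i = vertex s (f i).
Proof. by rewrite /vertex -pull_comp; congr pull; apply: dinj_eq. Qed.

Lemma nth_pull x0 p q (f : dinj p q) (s : X q) (i : 'I_p.+1) :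
  nth x0 (vertices (pull f s)) i = nth x0 (vertices s) (f i).
Proof. by rewrite !nth_vertices vertex_pull. Qed.

Lemma vertices_eqP p (s t : X p) : (forall i, vertex s i = vertex t i) -> s = t.
Proof. by move=> h; apply: vertices_inj; apply: eq_map. Qed.

Lemma nth_face x0 p (j : 'I_p.+2) (s : X p.+1) i : (i <= p)%N ->
  nth x0 (vertices (face j s)) i = nth x0 (vertices s) (bump j i).
Proof. by rewrite -ltnS => ip; rewrite -[i]/(val (Ordinal ip)) nth_pull. Qed.

Lemma face_inj p (z : X p.+1) : injective ((@face n X p)^~ z).
Proof.
move=> i j /(congr1 (@vertices n X p)) e; apply: val_inj; apply: contrapT => nij.
wlog ij : i j e nij / (i < j)%N.
  move=> w; case: (ltngtP i j) => // h; first exact: (w i j).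
  by apply: (w j i) => // /esym.
have x0 := vertex z ord0.
have ip : (i <= p)%N by rewrite -ltnS (leq_trans ij) // -ltnS.
have := congr1 (fun s => nth x0 s i) e; rewrite !nth_face //.
rewrite /bump leqnn leqNgt ij add0n add1n => /eqP.
rewrite nth_uniq ?size_vertices ?vertices_uniq ?ltnS //; last exact: ltnW.
by rewrite -[_ == _]/(i.+1 == i) eqn_leq ltnn.
Qed.

Lemma front_homo p q : {homo widen_ord (leq_addr q p.+1) : i j / (i < j)%N}.
Proof. by []. Qed.
Definition dfront p q : dinj p (p + q) := DInj (@front_homo p q).

Lemma back_subproof p q (i : 'I_q.+1) : (p + i < (p + q).+1)%N.
Proof. by rewrite ltnS leq_add2l -ltnS. Qed.
Lemma back_homo p q :
  {homo (fun i : 'I_q.+1 => Ordinal (back_subproof p i)) : i j / (i < j)%N}.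
Proof. by move=> i j /=; rewrite ltn_add2l. Qed.
Definition dback p q : dinj q (p + q) := DInj (@back_homo p q).

Definition front p q (u : X (p + q)%N) : X p := pull (dfront p q) u.
Definition back p q (u : X (p + q)%N) : X q := pull (dback p q) u.

Lemma nth_front x0 p q (u : X (p + q)%N) i : (i <= p)%N ->
  nth x0 (vertices (front u)) i = nth x0 (vertices u) i.
Proof. by rewrite -ltnS => ip; rewrite -[i]/(val (Ordinal ip)) nth_pull. Qed.

Lemma nth_back x0 p q (u : X (p + q)%N) i : (i <= q)%N ->
  nth x0 (vertices (back u)) i = nth x0 (vertices u) (p + i).
Proof.
by rewrite -ltnS => ip; rewrite -[in LHS](_ : val (Ordinal ip) = i) // nth_pull.
Qed.

Lemma eq_vertices p (s t : X p) :
  (forall x0 i, (i <= p)%N -> nth x0 (vertices s) i = nth x0 (vertices t) i) ->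
  s = t.
Proof.
move=> h; apply: vertices_inj; apply: (@eq_from_nth _ (vertex s ord0)).
  by rewrite !size_vertices.
by move=> i; rewrite size_vertices ltnS; apply: h.
Qed.

Lemma eq_vertices_nth p (s t : X p) x0 :
  (forall i, (i <= p)%N -> nth x0 (vertices s) i = nth x0 (vertices t) i) ->
  s = t.
Proof.
move=> h; apply: vertices_inj; apply: (@eq_from_nth _ x0).
  by rewrite !size_vertices.
by move=> i; rewrite size_vertices ltnS; apply: h.
Qed.

Lemma concatP p q (s : X p) (t : X q) (u : X (p + q)%N) :
  (concat s t == Some u) = (front u == s) && (back u == t).
Proof.
have x0 : X 0%N := source s.
have vE (v : X (p + q)%N) : (target s == source t) &&
    (vertices v == vertices s ++ behead (vertices t)) =
    (front v == s) && (back v == t).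
  have nthc i : nth x0 (vertices s ++ behead (vertices t)) i =
      if (i <= p)%N then nth x0 (vertices s) i
      else nth x0 (vertices t) (i - p).
    rewrite nth_cat size_vertices ltnS; case: leqP => // ip.
    by rewrite nth_behead subnS prednK // subn_gt0.
  have tE : target s = nth x0 (vertices s) p.
    by rewrite -[p in RHS]/(val (@ord_max p)) nth_vertices.
  have sE : source t = nth x0 (vertices t) 0.
    by rewrite -[0%N in RHS]/(val (@ord0 q)) nth_vertices.
  apply/andP/andP => [[/eqP st /eqP e]|[/eqP <- /eqP <-]]; split; apply/eqP.
  - apply: (@eq_vertices_nth _ _ _ x0) => i ip.
    by rewrite nth_front // e nthc ip.
  - apply: (@eq_vertices_nth _ _ _ x0) => i iq; rewrite nth_back // e nthc.
    by case: i iq => [|i] iq; rewrite ?addn0 ?leqnn -?tE ?st -?sE //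
      addnS ltnNge leq_addr /= -addnS addKn.
  - have e1 : target (front v) = nth x0 (vertices (front v)) p.
      by rewrite -[p in RHS]/(val (@ord_max p)) nth_vertices.
    have e2 : source (back v) = nth x0 (vertices (back v)) 0.
      by rewrite -[0%N in RHS]/(val (@ord0 q)) nth_vertices.
    by rewrite e1 e2 nth_front // nth_back // addn0.
  - apply: (@eq_from_nth _ x0).
      by rewrite size_cat size_behead !size_vertices.
    move=> i; rewrite size_vertices ltnS => ipq.
    rewrite nth_cat size_vertices ltnS; case: leqP => ip; first by rewrite nth_front.
    rewrite nth_behead subnS prednK ?subn_gt0 // nth_back; first by rewrite subnKC // ltnW.
    by rewrite leq_subLR.
rewrite /concat; have := vE; case: eqP => /= [_|_] {}vE; last by rewrite -vE.
case: pickP => [v|no]; last by rewrite -vE no.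
rewrite vE => /andP[/eqP fv /eqP bv].
rewrite (inj_eq Some_inj); apply/eqP/andP => [<-|[/eqP fu /eqP bu]].
  by rewrite fv bv !eqxx.
have /eqP eu : vertices u == vertices s ++ behead (vertices t) by rewrite vE fu bu !eqxx.
have /eqP ev : vertices v == vertices s ++ behead (vertices t) by rewrite vE fv bv !eqxx.
by apply: vertices_inj; rewrite eu ev.
Qed.

Lemma dinj_leq p q (f : dinj p q) : (p <= q)%N.
Proof.
have fi : injective f.
  move=> i j e; apply: val_inj; case: (ltngtP i j) => // /(dinj_homo f).
    by rewrite e ltnn.
  by rewrite e ltnn.
by have := leq_card f fi; rewrite !card_ord.
Qed.

Lemma dinj_ge p q (f : dinj p q) (i : 'I_p.+1) : (i <= f i)%N.
Proof.
case: i => i ip; elim: i ip => // i IH ip.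
have ip' := ltnW ip; apply: leq_ltn_trans (IH ip') _.
exact: (@dinj_homo p q f (Ordinal ip') (Ordinal ip)).
Qed.

Lemma dinj_eq_id p (f : dinj p p) : f = dinj_id p.
Proof.
apply: dinj_eq => i; apply: val_inj => /=; apply/eqP.
rewrite eqn_leq dinj_ge andbT.
have aux m : forall i : 'I_p.+1, (m = p - i)%N -> (f i <= i)%N.
  elim: m => [|m IH] {}i mE.
    apply: (@leq_trans p); first by rewrite -ltnS.
    by rewrite -subn_eq0 -mE.
  have ip : (i < p)%N by rewrite -subn_gt0 -mE.
  have := IH (@Ordinal p.+1 i.+1 ip); rewrite /= subnS -mE => /(_ erefl) h.
  by rewrite -ltnS; apply: leq_trans h; apply: dinj_homo => /=.
exact: aux.
Qed.

Lemma dinj_factor p q (f : dinj p q.+1) (j : 'I_q.+2) :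
  (forall i, f i != j) -> exists g : dinj p q, f = dinj_comp (coface j) g.
Proof.
move=> fj.
have [g gE] : exists g : 'I_p.+1 -> 'I_q.+1, forall i, f i = lift j (g i).
  have h i : exists k, f i = lift j k.
    have := unlift_some (_ : j != f i); rewrite eq_sym fj => /(_ isT)[k kE _].
    by exists k.
  exists (fun i => odflt ord0 (unlift j (f i))) => i.
  by case: (h i) => k ->; rewrite liftK.
have gh : {homo g : i k / (i < k)%N}.
  move=> i k /(dinj_homo f); rewrite !gE /= !ltnNge.
  by rewrite leq_bump2.
by exists (DInj gh); apply: dinj_eq => i; rewrite /= gE.
Qed.

Lemma dinj_miss p q (f : dinj p q) : (p < q)%N -> exists j, forall i, f i != j.
Proof.
move=> pq; apply: contrapT => no.
have : (#|[set: 'I_q.+1]| <= #|[set f x | x in setT]|)%N.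
  apply/subset_leq_card/subsetP => j _; apply: contrapT => nj.
  by apply: no; exists j => i; apply/eqP => e; apply: nj; rewrite -e imset_f.
have := leq_imset_card f (mem setT).
rewrite !cardsT !card_ord => h1 h2; have := leq_trans h2 h1.
by rewrite ltnNge pq.
Qed.

Lemma face_chain_pull p q (f : dinj p q) (z : X q) :
  inhabited (face_chain (pull f z) z).
Proof.
elim: q f z => [|q IH] f z.
  have := dinj_leq f; rewrite leqn0 => /eqP e; subst p.
  by rewrite (dinj_eq_id f) pull_id; constructor; apply: FaceChainNil.
have := dinj_leq f; rewrite leq_eqVlt => /orP[/eqP e|pq].
  subst p; rewrite (dinj_eq_id f) pull_id; constructor; exact: FaceChainNil.
have [j fj] := dinj_miss f pq; have [g ->] := dinj_factor fj.
rewrite pull_comp; have [c] := IH g (face j z).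
by constructor; apply: FaceChainStep c.
Qed.

Lemma face_leP p q (s : X p) (t : X q) :
  face_le s t <-> exists f : dinj p q, s = pull f t.
Proof.
split=> [[c]|[f ->]]; last exact: face_chain_pull.
elim: c => [|{}q {}t z j e _ [f ->]]; first by exists (dinj_id p); rewrite pull_id.
by exists (dinj_comp (coface j) f); rewrite pull_comp -[pull (coface j) z]/(face j z) e.
Qed.

Lemma face_le_refl p (s : X p) : face_le s s.
Proof. by constructor; apply: FaceChainNil. Qed.

Lemma face_le_trans p q r (s : X p) (t : X q) (u : X r) :
  face_le s t -> face_le t u -> face_le s u.
Proof.
move=> /face_leP[f ->] /face_leP[g ->]; apply/face_leP.
by exists (dinj_comp g f); rewrite pull_comp.
Qed.

Lemma face_le_face p (j : 'I_p.+2) (z : X p.+1) : face_le (face j z) z.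
Proof. by constructor; apply: FaceChainStep FaceChainNil. Qed.

Lemma face_le_back p q (u : X (p + q)%N) : face_le (back u) u.
Proof. by apply/face_leP; eexists. Qed.

Lemma concat_le p q (s : X p) (t : X q) (u : X (p + q)%N) :
  concat s t = Some u -> face_le t u.
Proof.
by move/eqP; rewrite concatP => /andP[_ /eqP <-]; apply: face_le_back.
Qed.

Lemma face_chain_leq p q (s : X p) (t : X q) : face_chain s t -> (p <= q)%N.
Proof. by elim=> // {}q {}t z j _ _ h; apply: leqW. Qed.

Lemma face_le_eq p (s t : X p) : face_le s t -> s = t.
Proof. by move=> /face_leP[f ->]; rewrite (dinj_eq_id f) pull_id. Qed.

End Combinatorics.

Lemma existT_inj (A : Type) (P : A -> Type) (a : A) (x y : P a) :
  existT P a x = existT P a y -> x = y.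
Proof.
by move=> e; have := projT2_eq e; rewrite (Prop_irrelevance (projT1_eq e) erefl).
Qed.

Lemma lift_liftP p (i j : 'I_p.+2) (i' j' : 'I_p.+1) :
  lift i i' = j -> lift j j' = i ->
  (forall k, lift i (lift i' k) = lift j (lift j' k)) /\
  ((i < j)%N /\ i = j' :> nat /\ j = i'.+1 :> nat \/
   (j < i)%N /\ j = i' :> nat /\ i = j'.+1 :> nat).
Proof.
move=> /(congr1 val) /= ij /(congr1 val) /= ji.
have h : (i < j)%N /\ i = j' :> nat /\ j = i'.+1 :> nat \/
         (j < i)%N /\ j = i' :> nat /\ i = j'.+1 :> nat.
  by move: ij ji; rewrite /bump; lia.
by split=> // k; apply: val_inj; rewrite /= /bump; lia.
Qed.

Lemma sign_lift (R : pzRingType) p (i j : 'I_p.+2) (i' j' : 'I_p.+1) :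
  lift i i' = j -> lift j j' = i ->
  (-1) ^+ i * (-1) ^+ i' = - ((-1) ^+ j * (-1) ^+ j') :> R.
Proof.
move=> ij ji; have [_] := lift_liftP ij ji.
rewrite -!exprD; case=> [[_ [-> ->]]|[_ [-> ->]]].
  by rewrite addSn addnC exprS mulN1r opprK.
by rewrite addSn addnC exprS mulN1r.
Qed.

Lemma lift_unliftP p (i j : 'I_p.+1) : i != j -> exists k, lift i k = j.
Proof. by move=> /unlift_some[k -> _]; exists k. Qed.

Lemma sum_antisym (V : zmodType) m (G : 'I_m -> 'I_m -> V) :
  (forall i, G i i = 0) -> (forall i j, G i j = - G j i) ->
  \sum_i \sum_j G i j = 0.
Proof.
move=> G0 GN.
pose H (i j : 'I_m) := if (i < j)%N then G i j else 0.
have -> : \sum_i \sum_j G i j = \sum_i \sum_j (H i j - H j i).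
  apply: eq_bigr => i _; apply: eq_bigr => j _; rewrite /H.
  case: (ltngtP (val i) (val j)) => [_|_|/val_inj ->]; rewrite ?subr0 ?sub0r ?G0 -?GN ?oppr0 //.
under eq_bigr do rewrite sumrB.
by rewrite sumrB exchange_big subrr.
Qed.

Lemma sum_lift_antisym (V : zmodType) p (f : 'I_p.+2 -> 'I_p.+1 -> V) :
  (forall i i' j j', lift i i' = j -> lift j j' = i -> f i i' = - f j j') ->
  \sum_i \sum_i' f i i' = 0.
Proof.
move=> fN.
pose G i j := if unlift i j is Some i' then f i i' else 0.
have Gii i : G i i = 0 by rewrite /G unlift_none.
have -> : \sum_i \sum_i' f i i' = \sum_i \sum_j G i j.
  apply: eq_bigr => i _; rewrite (bigD1_ord i) //= Gii add0r.
  by apply: eq_bigr => i' _; rewrite /G liftK.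
apply: sum_antisym => // i j; have [->|] := eqVneq i j; first by rewrite Gii oppr0.
move=> ij; have [i' ei] := lift_unliftP ij; rewrite eq_sym in ij.
have [j' ej] := lift_unliftP ij.
have ui : unlift i j = Some i' by rewrite -ei liftK.
have uj : unlift j i = Some j' by rewrite -ej liftK.
by rewrite /G ui uj; apply: fN.
Qed.

Section ChainCombinatorics.
Variables (n : nat) (X : nsset n).

Lemma coface_coface p (i j : 'I_p.+3) (i' j' : 'I_p.+2) :
  lift i i' = j -> lift j j' = i ->
  dinj_comp (coface i) (coface i') = dinj_comp (coface j) (coface j').
Proof. by move=> ij ji; apply: dinj_eq => k /=; case: (lift_liftP ij ji) => ->. Qed.

Lemma face_face p (z : X p.+2) (i j : 'I_p.+3) (i' j' : 'I_p.+2) :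
  lift i i' = j -> lift j j' = i -> face i' (face i z) = face j' (face j z).
Proof. by move=> ij ji; rewrite /face -!pull_comp (coface_coface ij ji). Qed.

Lemma pull_inj p q (z : X q) (f g : dinj p q) : pull f z = pull g z -> f = g.
Proof.
move=> e; apply: dinj_eq => i; apply: (@vertex_inj n X q z).
by rewrite -!vertex_pull e.
Qed.

Lemma face_face_inj p (z : X p.+2) (i j : 'I_p.+3) (i' j' : 'I_p.+2) :
  i != j -> face i' (face i z) = face j' (face j z) ->
  lift i i' = j /\ lift j j' = i.
Proof.
move=> ij; rewrite /face -!pull_comp => /pull_inj e.
have lE k : lift i (lift i' k) = lift j (lift j' k).
  by have := congr1 (fun f : dinj _ _ => f k) e.
split.
  have [k kE] := lift_unliftP ij; rewrite -kE; congr lift.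
  apply: contrapT => /eqP /lift_unliftP[l lk].
  by have := lE l; rewrite lk kE => /eqP; rewrite (negbTE (neq_lift _ _)).
have [k kE] : exists k, lift j k = i by apply: lift_unliftP; rewrite eq_sym.
rewrite -kE; congr lift.
apply: contrapT => /eqP /lift_unliftP[l lk].
by have := lE l; rewrite lk kE => /esym/eqP; rewrite (negbTE (neq_lift _ _)).
Qed.

Lemma face_face_third p (z : X p.+2) (i a : 'I_p.+3) (i' a' : 'I_p.+2) :
  face i' (face i z) = face a' (face a z) -> a = i \/ a = lift i i'.
Proof.
by have [->|] := eqVneq i a; [left|move=> ia /(face_face_inj ia)[<-]; right].
Qed.

Lemma face_le_two p q (s : X p) (z : X q.+2) (i j : 'I_q.+3) (i' j' : 'I_q.+2) :
  lift i i' = j -> lift j j' = i ->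
  face_le s (face i z) -> face_le s (face j z) -> face_le s (face i' (face i z)).
Proof.
move=> ij ji /face_leP[f sf] /face_leP[g sg].
have e : dinj_comp (coface i) f = dinj_comp (coface j) g.
  by apply: (@pull_inj _ _ z); rewrite !pull_comp -/(face i z) -/(face j z) -sf.
have [h hE] : exists h, f = dinj_comp (coface i') h.
  apply: dinj_factor => k; apply/eqP => fk.
  have := congr1 (fun f : dinj _ _ => f k) e; rewrite /= fk ij => /eqP.
  by rewrite (negbTE (neq_lift _ _)).
by apply/face_leP; exists h; rewrite sf hE pull_comp.
Qed.

Lemma face_le_two0 p (s : X p) (z : X 1%N) (i j : 'I_2) :
  face_le s (face i z) -> face_le s (face j z) -> i = j.
Proof.
move=> ai aj; have /face_leP[f _] := ai.
have := dinj_leq f; rewrite leqn0 => /eqP p0; subst p.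
by apply: (face_inj (z := z)); rewrite -(face_le_eq ai) -(face_le_eq aj).
Qed.

Variables (k : fieldType) (V : forall q, X q -> vectType k).
Variable E : forall q (t : X q) (z : X q.+1), 'I_q.+2 -> 'Hom(V t, V z).

Fixpoint chain_comp p (s : X p) q (t : X q) (c : face_chain s t) {struct c} :
    'Hom(V s, V t) :=
  match c in @face_chain _ _ _ _ q' t' return 'Hom(V s, V t') with
  | FaceChainNil => \1%VF
  | FaceChainStep _ t z j _ c' => (E t z j \o chain_comp c')%VF
  end.

Lemma face_chain_invS p (s : X p) q (z : X q.+1) (c : face_chain s z) :
  (p <= q)%N ->
  exists t j (e : face j z = t) (c' : face_chain s t), c = FaceChainStep j e c'.
Proof.
pose P p (s : X p) q' : forall z' : X q', face_chain s z' -> Prop :=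
  match q' with
  | 0 => fun _ _ => True
  | q.+1 => fun z c => (p <= q)%N -> exists t j (e : face j z = t)
        (c' : face_chain s t), c = FaceChainStep j e c'
  end.
suff h q' (z' : X q') (c' : face_chain s z') : P p s q' z' c'.
  exact: (h q.+1 z c).
case: q' z' / c' => [|q' t' z' j e c'] /=; last by move=> _; exists t', j, e, c'.
clear; case: p s => //= p' s'.
by rewrite ltnn.
Qed.

Lemma face_chain_inv0 p (s : X p) q (z : X q) (c : face_chain s z) :
  (q <= p)%N ->
  existT (fun q => {z : X q & face_chain s z}) q (existT _ z c) =
  existT (fun q => {z : X q & face_chain s z}) p (existT _ s FaceChainNil).
Proof.
case: q z / c => [//|q t z j e c] h.
by have := leq_trans h (face_chain_leq c); rewrite ltnn.
Qed.

Hypothesis Esq : forall q (u : X q) (t t' : X q.+1) (z : X q.+2)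
    (i j : 'I_q.+3) (i' j' : 'I_q.+2),
  lift i i' = j -> lift j j' = i ->
  face i z = t -> face j z = t' -> face i' t = u -> face j' t' = u ->
  (E t z i \o E u t i' = E t' z j \o E u t' j')%VF.

Lemma chain_comp_uniq p (s : X p) q (z : X q) (c c' : face_chain s z) :
  chain_comp c = chain_comp c'.
Proof.
elim: q z c c' => [|q IH] z c c'.
  have e := etrans (face_chain_inv0 c (leq0n p)) (esym (face_chain_inv0 c' (leq0n p))).
  by rewrite (existT_inj (existT_inj e)).
case: (leqP p q) => [pq|qp]; last first.
  have e := etrans (face_chain_inv0 c qp) (esym (face_chain_inv0 c' qp)).
  by rewrite (existT_inj (existT_inj e)).
have [t [i [e1 [c1 ->]]]] := face_chain_invS c pq.
have [t' [j [e2 [c2 ->]]]] := face_chain_invS c' pq => /=.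
have [ij|ij] := eqVneq i j.
  by subst; rewrite (IH _ c1 c2).
case: q IH z t t' i j e1 e2 c1 c2 ij {c c' pq} => [|q] IH z t t' i j e1 e2 c1 c2 ij.
  have := @face_le_two0 _ s z i j; rewrite e1 e2 => /(_ (inhabits c1) (inhabits c2)) e.
  by rewrite e eqxx in ij.
have [i' ei] := lift_unliftP ij; rewrite eq_sym in ij.
have [j' ej] := lift_unliftP ij.
have [d] : face_le s (face i' t).
  by rewrite -e1; apply: (face_le_two ei ej); rewrite ?e1 ?e2.
have e3 : face j' t' = face i' t by rewrite -e1 -e2 (face_face z ei ej).
rewrite (IH t c1 (FaceChainStep i' erefl d)) (IH t' c2 (FaceChainStep j' e3 d)) /=.
by rewrite !comp_lfunA (Esq ei ej e1 e2 erefl e3).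
Qed.

Fixpoint chain_cat p (s : X p) q (t : X q) r (u : X r) (a : face_chain s t)
    (b : face_chain t u) {struct b} : face_chain s u :=
  match b in @face_chain _ _ _ _ r' u' return face_chain s u' with
  | FaceChainNil => a
  | FaceChainStep _ _ _ j e b' => FaceChainStep j e (chain_cat a b')
  end.

Lemma chain_comp_cat p (s : X p) q (t : X q) r (u : X r) (a : face_chain s t)
    (b : face_chain t u) :
  chain_comp (chain_cat a b) = (chain_comp b \o chain_comp a)%VF.
Proof.
by elim: b => [|{}r {}t' {}u j e b IH] /=; rewrite ?comp_lfun1l // IH comp_lfunA.
Qed.

Definition some_chain p (s : X p) q (t : X q) (h : face_le s t) :
  face_chain s t := inhabited_witness h.

End ChainCombinatorics.

Section Sheaves.
Variables (k : fieldType) (n : nat) (X : nsset n).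

Record sheaf := Sheaf {
  sh_ob :> forall p, X p -> vectType k;
  sh_map : forall p q (s : X p) (t : X q),
    face_le s t -> 'Hom(sh_ob s, sh_ob t);
  sh_map_id : forall p (s : X p) (h : face_le s s), sh_map h = \1%VF;
  sh_map_comp : forall p q r (s : X p) (t : X q) (u : X r)
    (st : face_le s t) (tu : face_le t u) (su : face_le s u),
    sh_map su = (sh_map tu \o sh_map st)%VF
}.

Record sheaf_hom (F G : sheaf) := SheafHom {
  shh_map :> forall p (s : X p), 'Hom(F p s, G p s);
  shh_nat : forall p q (s : X p) (t : X q) (h : face_le s t),
    (shh_map t \o sh_map F h = sh_map G h \o shh_map s)%VF
}.

Lemma sheaf_hom_eq (F G : sheaf) (f g : sheaf_hom F G) :
  (forall p (s : X p), f p s = g p s) -> f = g.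
Proof.
case: f g => f hf [g hg] /= e.
have {}e : f = g by apply: functional_extensionality_dep => p;
  apply: functional_extensionality_dep => s; apply: e.
by subst g; congr SheafHom; apply: Prop_irrelevance.
Qed.

Lemma sheaf_id_nat (F : sheaf) p q (s : X p) (t : X q) (h : face_le s t) :
  (\1 \o sh_map F h = sh_map F h \o \1)%VF.
Proof. by rewrite comp_lfun1l comp_lfun1r. Qed.

Definition sheaf_id (F : sheaf) : sheaf_hom F F :=
  SheafHom (shh_map := fun p s => \1%VF) (@sheaf_id_nat F).

Lemma sheaf_comp_nat (F G H : sheaf) (g : sheaf_hom G H) (f : sheaf_hom F G)
    p q (s : X p) (t : X q) (h : face_le s t) :
  ((g q t \o f q t) \o sh_map F h = sh_map H h \o (g p s \o f p s))%VF.
Proof. by rewrite -comp_lfunA shh_nat comp_lfunA shh_nat comp_lfunA. Qed.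

Definition sheaf_comp (F G H : sheaf) (g : sheaf_hom G H) (f : sheaf_hom F G) :
    sheaf_hom F H :=
  SheafHom (shh_map := fun p s => (g p s \o f p s)%VF) (@sheaf_comp_nat F G H g f).

Definition Sh : category.
refine (@Category sheaf sheaf_hom sheaf_id sheaf_comp _ _ _).
- by move=> F G f; apply: sheaf_hom_eq => p s; apply: comp_lfun1l.
- by move=> F G f; apply: sheaf_hom_eq => p s; apply: comp_lfun1r.
- by move=> F G H K f g h; apply: sheaf_hom_eq => p s; apply: comp_lfunA.
Defined.

End Sheaves.

(** Transport along an equality of degrees; in the laws below it only appears
    where the degrees of the two sides are not convertible. *)
Definition gcast (K : pzRingType) (V : nat -> lmodType K) p q (e : p = q) (x : V p) : V q :=
  ecast i (V i) e x.

Record dga (k : fieldType) := DGA {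
  dga_sort :> nat -> lmodType k;
  dga_mul : forall p q, dga_sort p -> dga_sort q -> dga_sort (p + q)%N;
  dga_one : dga_sort 0%N;
  dga_d : forall p, dga_sort p -> dga_sort p.+1;
  dga_mul_linearl : forall p q (b : dga_sort q),
    linear (fun a : dga_sort p => dga_mul a b);
  dga_mul_linearr : forall p q (a : dga_sort p),
    linear (fun b : dga_sort q => dga_mul a b);
  dga_d_linear : forall p, linear (@dga_d p);
  dga_mulA : forall p q r (a : dga_sort p) (b : dga_sort q) (c : dga_sort r),
    gcast (addnA p q r) (dga_mul a (dga_mul b c)) = dga_mul (dga_mul a b) c;
  dga_mul1 : forall p (a : dga_sort p), dga_mul dga_one a = a;
  dga_mulr1 : forall p (a : dga_sort p), gcast (addn0 p) (dga_mul a dga_one) = a;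
  dga_dd : forall p (a : dga_sort p), dga_d (dga_d a) = 0;
  dga_dM : forall p q (a : dga_sort p) (b : dga_sort q),
    dga_d (dga_mul a b) =
    dga_mul (dga_d a) b + (-1) ^+ p *: gcast (addnS p q) (dga_mul a (dga_d b))
}.

Record dg_struct (k : fieldType) (A : dga k) (M : nat -> lmodType k) := DGStruct {
  act : forall p q, A p -> M q -> M (p + q)%N;
  diff : forall q, M q -> M q.+1;
  act_linearl : forall p q (x : M q), linear (fun a : A p => act a x);
  act_linearr : forall p q (a : A p), linear (fun x : M q => act a x);
  diff_linear : forall q, linear (@diff q);
  actA : forall p q r (a : A p) (b : A q) (x : M r),
    gcast (addnA p q r) (act a (act b x)) = act (dga_mul a b) x;
  act1 : forall q (x : M q), act (dga_one A) x = x;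
  diff_diff : forall q (x : M q), diff (diff x) = 0;
  diff_act : forall p q (a : A p) (x : M q),
    diff (act a x) =
    act (dga_d a) x + (-1) ^+ p *: gcast (addnS p q) (act a (diff x))
}.

Record dg_module (k : fieldType) (A : dga k) := DGModule {
  dgm_sort :> nat -> lmodType k;
  dgm_struct :> dg_struct A dgm_sort
}.

Record dg_hom (k : fieldType) (A : dga k) (M N : dg_module A) := DGHom {
  dgh_map :> forall q, M q -> N q;
  dgh_linear : forall q, linear (@dgh_map q);
  dgh_act : forall p q (a : A p) (x : M q),
    dgh_map (act M a x) = act N a (dgh_map x);
  dgh_diff : forall q (x : M q), dgh_map (diff M x) = diff N (dgh_map x)
}.

Section DGHom.
Variables (k : fieldType) (A : dga k).

Lemma dg_hom_eq (M N : dg_module A) (f g : dg_hom M N) :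
  (forall q (x : M q), f q x = g q x) -> f = g.
Proof.
case: f g => f f1 f2 f3 [g g1 g2 g3] /= e.
have {}e : f = g by apply: functional_extensionality_dep => q; apply: funext; apply: e.
by subst g; congr DGHom; apply: Prop_irrelevance.
Qed.

Lemma dg_id_linear (M : dg_module A) q : linear (@id (M q)).
Proof. by []. Qed.

Definition dg_id (M : dg_module A) : dg_hom M M :=
  @DGHom k A M M (fun q x => x) (@dg_id_linear M)
    (fun _ _ _ _ => erefl) (fun _ _ => erefl).

Definition dg_comp (M N P : dg_module A) (g : dg_hom N P) (f : dg_hom M N) :
  dg_hom M P.
refine (@DGHom k A M P (fun q x => g q (f q x)) _ _ _).
- by move=> q a x y; rewrite !dgh_linear.
- by move=> p q a x; rewrite !dgh_act.
- by move=> q x; rewrite !dgh_diff.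
Defined.

End DGHom.

Section Omega.
Variables (k : fieldType) (n : nat) (X : nsset n).

Definition dform (p : nat) : lmodType k := {ffun X p -> k^o}.

Definition rho p (s : X p) : dform p := [ffun t => (t == s)%:R].

Definition wedge p q (a : dform p) (b : dform q) : dform (p + q)%N :=
  \sum_(s : X p) \sum_(t : X q)
    (a s * b t) *: (if concat s t is Some u then rho u else 0).

Definition unit_form : dform 0%N := \sum_(v : X 0%N) rho v.

Definition form_d p (a : dform p) : dform p.+1 :=
  \sum_(s : X p) a s *:
    \sum_(j < p.+2) \sum_(t : X p.+1 | face j t == s) (-1) ^+ j *: rho t.

Lemma sum_ffun1 (I : finType) (J : Type) (r : seq J) (P : pred J)
    (f : J -> {ffun I -> k^o}) x :
  (\sum_(i <- r | P i) f i) x = \sum_(i <- r | P i) f i x.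
Proof. by rewrite sum_ffunE. Qed.

Lemma wedgeE p q (a : dform p) (b : dform q) (u : X (p + q)%N) :
  wedge a b u = a (front u) * b (back u).
Proof.
have key (s : X p) (t : X q) :
    ((a s * b t) *: (if concat s t is Some v then rho v else 0) : dform _) u =
    if (front u == s) && (back u == t) then a s * b t else 0.
  rewrite -concatP ffunE; case: concat => [v|] /=; last first.
    by rewrite ffunE scaler0.
  rewrite ffunE (inj_eq Some_inj) eq_sym.
  by case: eqP => _; rewrite /GRing.scale /= ?mulr1 ?mulr0.
rewrite /wedge sum_ffun1 (bigD1 (front u)) //= sum_ffun1 (bigD1 (back u)) //=.
rewrite key !eqxx /= !big1 ?addr0 // => [s /negbTE su|t /negbTE tu].
  by rewrite sum_ffun1 big1 // => t _; rewrite key eq_sym su.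
by rewrite key [back u == t]eq_sym tu andbF.
Qed.

Lemma form_dE p (a : dform p) (t : X p.+1) :
  form_d a t = \sum_(j < p.+2) (-1) ^+ j * a (face j t).
Proof.
rewrite /form_d sum_ffun1.
under eq_bigr => s _.
  rewrite ffunE sum_ffun1.
  under eq_bigr => j _.
    rewrite (_ : _ t = if face j t == s then (-1) ^+ j else 0); last first.
      rewrite sum_ffun1 big_mkcond (bigD1 t) //= !ffunE eqxx.
      rewrite big1 ?addr0 => [|t' /negbTE tt'].
        by case: ifP => // _; rewrite /GRing.scale /= mulr1.
      by rewrite fun_if !ffunE [t == t']eq_sym tt' scaler0; case: ifP.
    over.
  over.
rewrite (eq_bigr (fun s => \sum_(j < p.+2) if face j t == s then (-1) ^+ j * a s else 0)).
  rewrite exchange_big; apply: eq_bigr => j _.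
  by rewrite -big_mkcond (big_pred1 (face j t)) // => s; rewrite eq_sym.
move=> s _; rewrite scaler_sumr; apply: eq_bigr => j _.
by case: ifP => _; rewrite /GRing.scale /= ?mulr0 // mulrC.
Qed.

End Omega.

Lemma leibniz_sum (R : pzRingType) (V : lmodType R) p q
    (T : 'I_(p + q).+2 -> V) (A : 'I_p.+2 -> V) (B : 'I_q.+2 -> V) :
  (forall (i : 'I_(p + q).+2) (a : 'I_p.+2), i = a :> nat -> (i <= p)%N ->
     T i = A a) ->
  (forall (i : 'I_(p + q).+2) (b : 'I_q.+2), i = (p + b)%N :> nat ->
     (0 < b)%N -> T i = B b) ->
  A ord_max = B ord0 ->
  \sum_(i < (p + q).+2) (-1) ^+ i *: T i =
  \sum_(i < p.+2) (-1) ^+ i *: A i +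
    (-1) ^+ p *: \sum_(j < q.+2) (-1) ^+ j *: B j.
Proof.
move=> TA TB AB.
rewrite [\sum_(i < p.+2) _]big_ord_recr /= AB.
rewrite [\sum_(j < q.+2) _]big_ord_recl /= scalerDr expr0 scale1r.
rewrite exprS mulN1r scaleNr addrA subrK.
pose T' i := T (inord i).
have -> : \sum_(i < (p + q).+2) (-1) ^+ i *: T i =
    \sum_(0 <= i < p.+1 + q.+1) (-1) ^+ i *: T' i.
  rewrite big_mkord addSn addnS.
  by apply: eq_bigr => i _; rewrite /T' inord_val.
rewrite (@big_cat_nat _ _ _ p.+1) //=; last by rewrite leq_addr.
congr (_ + _).
  rewrite big_mkord; apply: eq_bigr => i _ /=; congr (_ *: _); apply: TA => /=.
    by rewrite inordK //; have := ltn_ord i; lia.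
  by rewrite inordK; have := ltn_ord i; lia.
rewrite -{1}[p.+1]add0n big_addn addKn big_mkord scaler_sumr.
apply: eq_bigr => j _; rewrite scalerA -exprD /= /bump /= add1n.
rewrite (_ : j + p.+1 = p + j.+1)%N; last by lia.
congr (_ *: _); apply: TB => //=.
by rewrite inordK; have := ltn_ord j; rewrite /bump /=; lia.
Qed.

Section Cast.
Variables (n : nat) (X : nsset n).

Definition xcast p q (e : p = q) (s : X p) : X q := ecast i (X i) e s.

Lemma nth_xcast x0 p q (e : p = q) (s : X p) i :
  nth x0 (vertices (xcast e s)) i = nth x0 (vertices s) i.
Proof. by subst q. Qed.

Lemma nth_frontS x0 p q (u : X (p + q).+1%N) i : (i <= p.+1)%N ->
  nth x0 (vertices (front (u : X (p.+1 + q)%N))) i = nth x0 (vertices u) i.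
Proof. exact: (@nth_front n X x0 p.+1 q u). Qed.

Lemma nth_backS x0 p q (u : X (p + q).+1%N) i : (i <= q)%N ->
  nth x0 (vertices (back (u : X (p.+1 + q)%N))) i = nth x0 (vertices u) (p.+1 + i).
Proof. exact: (@nth_back n X x0 p.+1 q u). Qed.

Ltac bump_lia := rewrite ?/bump /=; lia.
Ltac simplices :=
  apply: eq_vertices => x0 m hm;
  repeat first
    [ rewrite nth_xcast
    | rewrite nth_frontS; last by bump_lia
    | rewrite nth_backS; last by bump_lia
    | rewrite nth_front; last by bump_lia
    | rewrite nth_back; last by bump_lia
    | rewrite nth_face; last by bump_lia ];
  congr (nth _ _ _); bump_lia.

Variables (p q r : nat).

Section Assoc.
Variable (w : X (p + q + r)%N).
Let w' := xcast (esym (addnA p q r)) w.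

Lemma front_assoc : front w' = front (front w).
Proof. simplices. Qed.
Lemma front_back_assoc : front (back w') = back (front w).
Proof. simplices. Qed.
Lemma back_assoc : back (back w') = back w.
Proof. by simplices. Qed.
End Assoc.

Section Faces.
Variable (z : X (p + q).+1%N).
Let z' := xcast (esym (addnS p q)) z.
Implicit Type i : 'I_(p + q).+2.

Lemma front_face_low i (a : 'I_p.+2) : i = a :> nat -> (i <= p)%N ->
  front (face i z) = face a (front (z : X (p.+1 + q)%N)).
Proof. by move=> e ip; simplices. Qed.

Lemma back_face_low i : (i <= p)%N ->
  back (face i z) = back (z : X (p.+1 + q)%N).
Proof. by move=> e; simplices. Qed.

Lemma front_face_high i (b : 'I_q.+2) : i = (p + b)%N :> nat -> (0 < b)%N ->
  front (face i z) = front z'.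
Proof. by move=> e b0; simplices. Qed.

Lemma back_face_high i (b : 'I_q.+2) : i = (p + b)%N :> nat -> (0 < b)%N ->
  back (face i z) = face b (back z').
Proof. by move=> e b0; simplices. Qed.

Lemma front_face_mid : face ord_max (front (z : X (p.+1 + q)%N)) = front z'.
Proof. by simplices. Qed.

Lemma back_face_mid : face ord0 (back z') = back (z : X (p.+1 + q)%N).
Proof. by simplices. Qed.
End Faces.

End Cast.

Section OmegaDGA.
Variables (k : fieldType) (n : nat) (X : nsset n).
Implicit Types p q r : nat.

Lemma gcast_formE p q (e : p = q) (a : dform k X p) (u : X q) :
  gcast e a u = a (xcast (esym e) u).
Proof. by subst q. Qed.

Lemma wedge_linearl p q (b : dform k X q) :
  linear (fun a : dform k X p => wedge a b).
Proof.
move=> c x y; apply/ffunP => u; rewrite !ffunE !wedgeE !ffunE.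
by rewrite /GRing.scale /= mulrDl mulrA.
Qed.

Lemma wedge_linearr p q (a : dform k X p) :
  linear (fun b : dform k X q => wedge a b).
Proof.
move=> c x y; apply/ffunP => u; rewrite !ffunE !wedgeE !ffunE.
by rewrite /GRing.scale /= mulrDr !mulrA [a _ * c]mulrC.
Qed.

Lemma form_d_linear p : linear (@form_d k n X p).
Proof.
move=> c x y; apply/ffunP => u; rewrite !ffunE !form_dE.
rewrite /GRing.scale /= mulr_sumr -big_split /=; apply: eq_bigr => i _.
by rewrite !ffunE /GRing.scale /= mulrDr !mulrA [c * _]mulrC.
Qed.

Lemma wedgeA p q r (a : dform k X p) (b : dform k X q) (c : dform k X r) :
  gcast (addnA p q r) (wedge a (wedge b c)) = wedge (wedge a b) c.
Proof.
apply/ffunP => w; rewrite gcast_formE !wedgeE.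
by rewrite front_assoc front_back_assoc back_assoc mulrA.
Qed.

Lemma unit_formE (v : X 0%N) : unit_form k X v = 1.
Proof.
rewrite /unit_form sum_ffun1 (bigD1 v) //= ffunE eqxx big1 ?addr0 // => u.
by rewrite ffunE eq_sym => /negbTE ->.
Qed.

Lemma back0 q (u : X (0 + q)%N) : back u = u.
Proof. exact: (@face_le_eq n X q _ _ (face_le_back u)). Qed.

Lemma wedge1 p (a : dform k X p) : wedge (unit_form k X) a = a.
Proof. by apply/ffunP => u; rewrite wedgeE unit_formE mul1r back0. Qed.

Lemma front0 p (u : X p) : front (xcast (esym (addn0 p)) u) = u.
Proof.
apply: eq_vertices => x0 m hm.
by rewrite nth_front // nth_xcast.
Qed.

Lemma wedger1 p (a : dform k X p) : gcast (addn0 p) (wedge a (unit_form k X)) = a.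
Proof.
by apply/ffunP => u; rewrite gcast_formE wedgeE unit_formE mulr1 front0.
Qed.

Lemma form_dd p (a : dform k X p) : form_d (form_d a) = 0.
Proof.
apply/ffunP => z; rewrite form_dE ffunE.
under eq_bigr do rewrite form_dE mulr_sumr.
apply: sum_lift_antisym => i i' j j' ij ji.
by rewrite !mulrA (sign_lift k ij ji) mulNr (face_face z ij ji).
Qed.

Lemma form_dM p q (a : dform k X p) (b : dform k X q) :
  form_d (wedge a b) =
  wedge (form_d a) b + (-1) ^+ p *: gcast (addnS p q) (wedge a (form_d b)).
Proof.
apply/ffunP => z; rewrite form_dE !ffunE gcast_formE.
rewrite (@wedgeE k n X p.+1 q) wedgeE !form_dE mulr_suml mulr_sumr.
set z' := xcast _ z.
have := @leibniz_sum k k^o p q (fun i => wedge a b (face i z))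
  (fun i => a (face i (front (z : X (p.+1 + q)%N))) * b (back (z : X (p.+1 + q)%N)))
  (fun j => a (front z') * b (face j (back z'))).
rewrite /GRing.scale /= => ->.
- congr (_ + _ * _); apply: eq_bigr => i _; first by rewrite mulrA.
  by rewrite mulrCA.
- by move=> i c ic ip; rewrite wedgeE (front_face_low z ic ip) (back_face_low z ip).
- by move=> i c ic ip; rewrite wedgeE (front_face_high z ic ip) (back_face_high z ic ip).
- by rewrite (front_face_mid z) (back_face_mid z).
Qed.

Definition Omega : dga k :=
  DGA wedge_linearl wedge_linearr form_d_linear wedgeA wedge1 wedger1 form_dd form_dM.

End OmegaDGA.

Import VectorInternalTheory.

Section DirectSum.
Variables (k : fieldType) (I : finType).

Definition dsum (V : I -> vectType k) : Type := {dffun forall i : I, V i}.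

Variable V : I -> vectType k.
Implicit Types f g h : dsum V.

HB.instance Definition _ := Choice.copy (dsum V) {dffun forall i : I, V i}.

Definition dsum_fun f : forall i, V i := fun i => (f : {dffun forall i : I, V i}) i.

Definition dsum_of (f : forall i, V i) : dsum V := [ffun i => f i].

Lemma dsum_ofE (f : forall i, V i) i : dsum_fun (dsum_of f) i = f i.
Proof. by rewrite /dsum_fun ffunE. Qed.

Lemma dsumP f g : (forall i, dsum_fun f i = dsum_fun g i) -> f = g.
Proof. by move=> e; apply/ffunP. Qed.

Definition dsum_add f g := dsum_of (fun i => dsum_fun f i + dsum_fun g i).
Definition dsum_opp f := dsum_of (fun i => - dsum_fun f i).
Definition dsum_zero := dsum_of (fun=> 0).
Definition dsum_scale (c : k) f := dsum_of (fun i => c *: dsum_fun f i).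

Lemma dsum_addA : associative dsum_add.
Proof. by move=> f g h; apply: dsumP => i; rewrite !dsum_ofE addrA. Qed.
Lemma dsum_addC : commutative dsum_add.
Proof. by move=> f g; apply: dsumP => i; rewrite !dsum_ofE addrC. Qed.
Lemma dsum_add0 : left_id dsum_zero dsum_add.
Proof. by move=> f; apply: dsumP => i; rewrite !dsum_ofE add0r. Qed.
Lemma dsum_addN : left_inverse dsum_zero dsum_opp dsum_add.
Proof. by move=> f; apply: dsumP => i; rewrite !dsum_ofE addNr. Qed.

HB.instance Definition _ :=
  GRing.isZmodule.Build (dsum V) dsum_addA dsum_addC dsum_add0 dsum_addN.

Lemma dsum_scaleA a b f : dsum_scale a (dsum_scale b f) = dsum_scale (a * b) f.
Proof. by apply: dsumP => i; rewrite !dsum_ofE scalerA. Qed.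
Lemma dsum_scale1 : left_id 1 dsum_scale.
Proof. by move=> f; apply: dsumP => i; rewrite !dsum_ofE scale1r. Qed.
Lemma dsum_scaleDr : right_distributive dsum_scale +%R.
Proof. by move=> c f g; apply: dsumP => i; rewrite !dsum_ofE scalerDr. Qed.
Lemma dsum_scaleDl f : {morph dsum_scale^~ f : a b / a + b}.
Proof. by move=> a b; apply: dsumP => i; rewrite !dsum_ofE scalerDl. Qed.

HB.instance Definition _ :=
  GRing.Zmodule_isLmodule.Build k (dsum V)
    dsum_scaleA dsum_scale1 dsum_scaleDr dsum_scaleDl.

Lemma dsum_vect_axiom : Vector.axiom (dim {ffun {i : I & 'I_(dim (V i))} -> k^o}) (dsum V).
Proof.
pose T := {i : I & 'I_(dim (V i))}.
pose f (x : dsum V) : {ffun T -> k^o} :=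
  [ffun u => v2r (dsum_fun x (tag u)) 0 (tagged u)].
pose g (y : {ffun T -> k^o}) : dsum V :=
  dsum_of (fun i => r2v (\row_j y (Tagged (fun i => 'I_(dim (V i))) j))).
have fl : linear f.
  move=> c x y; apply/ffunP => u; rewrite !ffunE.
  by rewrite dsum_ofE dsum_ofE linearP !mxE.
exists (fun x => v2r (f x)).
  by move=> c x y; rewrite fl linearP.
exists (fun r => g (r2v r)) => [x|r].
  rewrite v2rK; apply: dsumP => i; rewrite dsum_ofE; apply: (can_inj v2rK).
  by rewrite r2vK; apply/rowP => j; rewrite mxE ffunE.
apply: (can_inj r2vK); rewrite v2rK; apply/ffunP => -[i j].
by rewrite ffunE /= dsum_ofE r2vK mxE.
Qed.

HB.instance Definition _ := Lmodule_hasFinDim.Build k (dsum V) dsum_vect_axiom.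

Definition dsum_in (i : I) (x : V i) : dsum V := dsum_of (@dfwith I V (fun i => 0 : V i) i x).

Lemma dsum_in_eq i (x : V i) : dsum_fun (dsum_in x) i = x.
Proof. by rewrite dsum_ofE dfwith_in. Qed.

Lemma dsum_in_neq i j (x : V i) : i != j -> dsum_fun (dsum_in x) j = 0.
Proof. by move=> ij; rewrite dsum_ofE dfwith_out. Qed.

Lemma dsum_addE f g i : dsum_fun (f + g) i = dsum_fun f i + dsum_fun g i.
Proof. by rewrite dsum_ofE. Qed.
Lemma dsum_scaleE c f i : dsum_fun (c *: f) i = c *: dsum_fun f i.
Proof. by rewrite dsum_ofE. Qed.
Lemma dsum_zeroE i : dsum_fun (0 : dsum V) i = 0.
Proof. by rewrite dsum_ofE. Qed.

Lemma dsum_sumE J (r : seq J) (P : pred J) (F : J -> dsum V) i :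
  dsum_fun (\sum_(j <- r | P j) F j) i = \sum_(j <- r | P j) dsum_fun (F j) i.
Proof.
by elim/big_rec2: _ => [|j _ y _ <-]; rewrite ?dsum_zeroE ?dsum_addE.
Qed.

Lemma dsum_in_linear i : linear (@dsum_in i).
Proof.
move=> c x y; apply: dsumP => j; rewrite dsum_addE dsum_scaleE.
have [<-|ij] := eqVneq i j; first by rewrite !dsum_in_eq.
by rewrite !dsum_in_neq // scaler0 addr0.
Qed.

HB.instance Definition _ i := GRing.isLinear.Build k (V i) (dsum V) *:%R
  (@dsum_in i) (@dsum_in_linear i).

Lemma dsum_decomp f : f = \sum_i dsum_in (dsum_fun f i).
Proof.
apply: dsumP => i; rewrite dsum_sumE (bigD1 i) //= dsum_in_eq.
by rewrite big1 ?addr0 // => j ji; rewrite dsum_in_neq.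
Qed.

End DirectSum.

Section Cellular.
Variables (k : fieldType) (n : nat) (X : nsset n).

Section Component.
Variables (M : nat -> vectType k) (cell : forall q, X q -> {vspace M q}).
Hypothesis cell_full : forall q, fullv = (\sum_(t : X q) cell t)%VS.
Variable d : forall q, M q -> M q.+1.

Definition cell_proj q (t : X q) (x : M q) : subvs_of (cell t) :=
  vsproj (cell t) (sumv_pi_for (cell_full q) t x).

Definition cell_comp q (t : X q) (z : X q.+1) (x : subvs_of (cell t)) :
  subvs_of (cell z) := cell_proj z (d (vsval x)).

End Component.

(** [cell_full] and [cell_direct] say that [M q] is the internal direct sum of
    the [cell t]; for [n < q] the sum is empty, so that [M q] is zero.  Since
    there are finitely many finite-dimensional cells, every [M q] is
    finite-dimensional, hence [vectType] components lose no generality.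
    [cell_comp] is the component [D_{t -> z}] of the differential, and
    [cell_source] says that [cell t] is contained in the image of the action of
    the indicator function of the source of [t]. *)
Record cellular := Cellular {
  cm_sort :> nat -> vectType k;
  cm_struct : dg_struct (Omega k X) (fun q => cm_sort q : lmodType k);
  cell : forall q, X q -> {vspace cm_sort q};
  cell_full : forall q, fullv = (\sum_(t : X q) cell t)%VS;
  cell_direct : forall q, directv (\sum_(t : X q) cell t)%VS;
  cell_source : forall q (t : X q) (x : cm_sort q), x \in cell t ->
    exists y : cm_sort q, x = act cm_struct (rho k (source t)) y;
  cell_diff : forall q (t : X q) (x : subvs_of (cell t)),
    diff cm_struct (vsval x) =
    \sum_(i < q.+2) \sum_(z : X q.+1 | face i z == t)
      vsval (cell_comp cell_full (@diff _ _ _ cm_struct) z x)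
}.

Definition cm_dg (M : cellular) : dg_module (Omega k X) :=
  DGModule (cm_struct M).

Record cell_hom (M N : cellular) := CellHom {
  cellh_dg :> dg_hom (cm_dg M) (cm_dg N);
  cellh_cell : forall q (t : X q) (x : M q),
    x \in cell M t -> cellh_dg q x \in cell N t
}.

Lemma cell_hom_eq (M N : cellular) (f g : cell_hom M N) :
  (forall q (x : M q), f q x = g q x) -> f = g.
Proof.
case: f g => f f1 [g g1] /= e.
have {}e : f = g by apply: dg_hom_eq.
by subst g; congr CellHom; apply: Prop_irrelevance.
Qed.

Definition cell_id (M : cellular) : cell_hom M M :=
  @CellHom M M (dg_id (cm_dg M)) (fun _ _ _ h => h).

Definition cell_hcomp (M N P : cellular) (g : cell_hom N P) (f : cell_hom M N) :
    cell_hom M P :=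
  @CellHom M P (dg_comp g f) (fun _ _ _ h => cellh_cell g (cellh_cell f h)).

Definition Cell : category.
refine (@Category cellular cell_hom cell_id cell_hcomp _ _ _).
- by move=> M N f; apply: cell_hom_eq.
- by move=> M N f; apply: cell_hom_eq.
- by move=> M N P Q f g h; apply: cell_hom_eq.
Defined.

Section CellTheory.
Variable M : cellular.

Definition cproj q (t : X q) : M q -> subvs_of (cell M t) :=
  cell_proj (@cell_full M) t.

Lemma cproj_linear q (t : X q) : linear (@cproj q t).
Proof. by move=> c x y; rewrite /cproj /cell_proj !linearP. Qed.

HB.instance Definition _ q (t : X q) :=
  GRing.isLinear.Build k (M q) (subvs_of (cell M t)) *:%R (@cproj q t) (@cproj_linear q t).

Lemma cprojE q (t : X q) (x : M q) :
  vsval (cproj t x) = sumv_pi_for (cell_full M q) t x.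
Proof. by rewrite /cproj /cell_proj vsprojK // memv_sum_pi. Qed.

Lemma cproj_sum q (x : M q) : \sum_(t : X q) vsval (cproj t x) = x.
Proof.
under eq_bigr do rewrite cprojE.
by apply: sumv_pi_sum; rewrite memvf.
Qed.

Lemma cell_sum_inj q (f g : forall t : X q, subvs_of (cell M t)) :
  \sum_t vsval (f t) = \sum_t vsval (g t) -> forall t, f t = g t.
Proof.
move=> /eqP e t; apply: val_inj; 
have h := elimT (@directv_sum_unique k (M q) (X q) xpredT (@cell M q)) (cell_direct M q).
have := h (fun t => vsval (f t)) (fun t => vsval (g t))
  (fun t _ => subvsP (f t)) (fun t _ => subvsP (g t)).
by rewrite e => /esym/forall_inP/(_ t isT)/eqP.
Qed.

Lemma cproj_cell q (t t' : X q) (x : subvs_of (cell M t)) :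
  vsval (cproj t' (vsval x)) = if t == t' then vsval x else 0.
Proof.
pose f t' : subvs_of (cell M t') := vsproj (cell M t') (if t == t' then vsval x else 0).
have fE s : vsval (f s) = if t == s then vsval x else 0.
  rewrite /f vsprojK //; case: eqP => [<-|_]; last exact: mem0v.
  exact: subvsP.
rewrite -fE; congr (vsval _); apply: (cell_sum_inj (f := fun s => cproj s (vsval x)) (g := f)).
rewrite cproj_sum (bigD1 t) //= fE eqxx big1 ?addr0 // => s.
by rewrite fE eq_sym => /negbTE ->.
Qed.

Lemma cprojK q (t : X q) (x : subvs_of (cell M t)) : cproj t (vsval x) = x.
Proof. by apply: val_inj; rewrite /= cproj_cell eqxx. Qed.

Lemma cproj_neq q (t t' : X q) (x : subvs_of (cell M t)) :
  t != t' -> cproj t' (vsval x) = 0.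
Proof. by move=> /negbTE h; apply: val_inj; rewrite /= cproj_cell h. Qed.

Notation d := (@diff _ _ _ (cm_struct M)).

Definition Dcell q (t : X q) (z : X q.+1) :
    subvs_of (cell M t) -> subvs_of (cell M z) :=
  @cell_comp M (@cell M) (@cell_full M) d q t z.

Lemma DcellE q (t : X q) (z : X q.+1) x : Dcell z x = cproj z (d (vsval (x : subvs_of (cell M t)))).
Proof. by []. Qed.

Lemma Dcell_linear q (t : X q) (z : X q.+1) : linear (@Dcell q t z).
Proof.
by move=> c x y; rewrite !DcellE linearP (diff_linear (cm_struct M)) linearP.
Qed.

HB.instance Definition _ q (t : X q) (z : X q.+1) :=
  GRing.isLinear.Build k (subvs_of (cell M t)) (subvs_of (cell M z)) *:%R
    (@Dcell q t z) (@Dcell_linear q t z).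

Lemma cell_diffE q (t : X q) (x : subvs_of (cell M t)) :
  d (vsval x) = \sum_(z : X q.+1 | [exists i, face i z == t]) vsval (Dcell z x).
Proof.
rewrite cell_diff.
under eq_bigr do rewrite big_mkcond.
rewrite exchange_big [RHS]big_mkcond; apply: eq_bigr => z _.
case: existsP => [[i /eqP it]|no]; last first.
  by rewrite big1 // => i _; case: ifP => // h; case: no; exists i.
rewrite (bigD1 i) //= it eqxx big1 ?addr0 // => j ji.
case: eqP => // jt; case/eqP: ji; apply: (face_inj (z := z)).
by rewrite jt.
Qed.

Lemma Dcell0 q (t : X q) (z : X q.+1) (x : subvs_of (cell M t)) :
  (forall i, face i z != t) -> Dcell z x = 0.
Proof.
move=> h; rewrite DcellE cell_diffE linear_sum big1 //= => z' /existsP[i /eqP zi].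
by apply: cproj_neq; apply: contraNneq (h i) => <-; apply/eqP.
Qed.

Lemma Dcell_sq q (u : X q) (t t' : X q.+1) (z : X q.+2)
    (i j : 'I_q.+3) (i' j' : 'I_q.+2) (x : subvs_of (cell M u)) :
  lift i i' = j -> lift j j' = i ->
  face i z = t -> face j z = t' -> face i' t = u -> face j' t' = u ->
  Dcell z (Dcell t x) + Dcell z (Dcell t' x) = 0.
Proof.
move=> ij ji it jt iu ju.
have tt' : t' != t.
  apply/eqP => e; have := @face_inj n X _ z i j; rewrite /= it jt e => /(_ erefl) eij.
  by move: ij; rewrite -eij => /esym/eqP; rewrite (negbTE (neq_lift _ _)).
have : cproj z (d (d (vsval x))) = 0 by rewrite diff_diff linear0.
rewrite cell_diffE => <-.
have -> : forall J (r : seq J) (P : pred J) F,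
    d (\sum_(y <- r | P y) F y) = \sum_(y <- r | P y) (d (F y)).
  move=> q' J r P F; pose dl : {linear M q' -> M q'.+1} :=
    HB.pack (@diff _ _ _ (cm_struct M) q')
      (GRing.isLinear.Build _ _ _ _ _ (@diff_linear _ _ _ (cm_struct M) q')).
  exact: (linear_sum dl).
rewrite linear_sum (bigD1 t) /=; last by apply/existsP; exists i'; apply/eqP.
rewrite (bigD1 t') /=; last by rewrite tt' andbT; apply/existsP; exists j'; apply/eqP.
rewrite big1 ?addr0 // => s /andP[/andP[/existsP[b /eqP sb] st] st'].
apply: Dcell0 => a; apply/eqP => za; move: st st'.
have := @face_face_third n X q z i a i' b; rewrite it za iu sb => /(_ erefl)[e|e].
  by rewrite -za e it eqxx.
by move=> _; rewrite -za e ij jt eqxx.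
Qed.

(** The map F_M(t <= z) for [face i z = t]. *)
Definition cell_step q (t : X q) (z : X q.+1) (i : 'I_q.+2) :
    'Hom(subvs_of (cell M t), subvs_of (cell M z)) :=
  (-1) ^+ i *: linfun (@Dcell q t z).

Lemma cell_stepE q (t : X q) (z : X q.+1) (i : 'I_q.+2) x :
  cell_step t z i x = (-1) ^+ i *: Dcell z x.
Proof. by rewrite /cell_step scale_lfunE lfunE. Qed.

Lemma cell_step_sq q (u : X q) (t t' : X q.+1) (z : X q.+2)
    (i j : 'I_q.+3) (i' j' : 'I_q.+2) :
  lift i i' = j -> lift j j' = i ->
  face i z = t -> face j z = t' -> face i' t = u -> face j' t' = u ->
  (cell_step t z i \o cell_step u t i' = cell_step t' z j \o cell_step u t' j')%VF.
Proof.
move=> ij ji it jt iu ju; apply/lfunP => x.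
rewrite !comp_lfunE !cell_stepE !linearZ /= !scalerA.
rewrite mulrC [in RHS]mulrC (sign_lift k ij ji) scaleNr -scalerN; congr (_ *: _).
by apply/esym/eqP; rewrite -addr_eq0 addrC; apply/eqP/(Dcell_sq x ij ji it jt iu ju).
Qed.

(** [some_chain h] is an arbitrary chain; by [sheaf_map_chain] every chain gives
    the same composite. *)
Definition sheaf_map p q (s : X p) (t : X q) (h : face_le s t) :
    'Hom(subvs_of (cell M s), subvs_of (cell M t)) :=
  chain_comp cell_step (some_chain h).

Lemma sheaf_map_chain p q (s : X p) (t : X q) (h : face_le s t)
  (c : face_chain s t) : sheaf_map h = chain_comp cell_step c.
Proof.
exact: (@chain_comp_uniq n X k (fun q t => subvs_of (cell M t)) cell_step
  cell_step_sq p s q t).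
Qed.

Lemma sheaf_map_id p (s : X p) (h : face_le s s) : sheaf_map h = \1%VF.
Proof. by rewrite (sheaf_map_chain h FaceChainNil). Qed.

Lemma sheaf_map_comp p q r (s : X p) (t : X q) (u : X r)
    (st : face_le s t) (tu : face_le t u) (su : face_le s u) :
  sheaf_map su = (sheaf_map tu \o sheaf_map st)%VF.
Proof.
case: (st) (tu) => [a] [b].
by rewrite (sheaf_map_chain _ a) (sheaf_map_chain _ b)
  (sheaf_map_chain _ (chain_cat a b)) chain_comp_cat.
Qed.

Definition sheaf_of : sheaf k X :=
  @Sheaf k n X (fun p (s : X p) => subvs_of (cell M s)) sheaf_map
    sheaf_map_id sheaf_map_comp.

End CellTheory.

Section RestrictHom.
Variables (M N : cellular) (f : cell_hom M N).

Lemma cellh_sum q J (r : seq J) (P : pred J) (F : J -> M q) :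
  f q (\sum_(y <- r | P y) F y) = \sum_(y <- r | P y) f q (F y).
Proof.
pose fl : {linear M q -> N q} := HB.pack (dgh_map f (q := q))
  (GRing.isLinear.Build _ _ _ _ _ (dgh_linear f (q := q))).
exact: (linear_sum fl).
Qed.

Definition cellh_res q (t : X q) (x : subvs_of (cell M t)) : subvs_of (cell N t) :=
  vsproj (cell N t) (f q (vsval x)).

Lemma cellh_resE q (t : X q) (x : subvs_of (cell M t)) :
  vsval (cellh_res x) = f q (vsval x).
Proof. by rewrite /cellh_res vsprojK //; apply: cellh_cell; apply: subvsP. Qed.

Lemma cellh_res_linear q (t : X q) : linear (@cellh_res q t).
Proof.
move=> c x y; apply: val_inj; rewrite -[LHS]/(vsval _) -[RHS]/(vsval _).
have vsD t' (v w : subvs_of (cell N t')) :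
  vsval (c *: v + w : subvs_of (cell N (t' : X q))) = c *: vsval v + vsval w by [].
by rewrite vsD !cellh_resE -(dgh_linear f).
Qed.

HB.instance Definition _ q (t : X q) :=
  GRing.isLinear.Build k (subvs_of (cell M t)) (subvs_of (cell N t)) *:%R
    (@cellh_res q t) (@cellh_res_linear q t).

Lemma cellh_cproj q (t : X q) (x : M q) : cproj t (f q x) = cellh_res (cproj t x).
Proof.
rewrite -{1}(cproj_sum x) cellh_sum linear_sum (bigD1 t) //= -cellh_resE cprojK.
rewrite big1 ?addr0 // => s st; rewrite -cellh_resE; exact: cproj_neq.
Qed.

Lemma cellh_Dcell q (t : X q) (z : X q.+1) (x : subvs_of (cell M t)) :
  Dcell z (cellh_res x) = cellh_res (Dcell z x).
Proof. by rewrite !DcellE cellh_resE -(dgh_diff f) cellh_cproj. Qed.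

Lemma cellh_res_nat p q (s : X p) (t : X q) (h : face_le s t) :
  (linfun (@cellh_res q t) \o sheaf_map M h =
   sheaf_map N h \o linfun (@cellh_res p s))%VF.
Proof.
case: (h) => c; rewrite !(sheaf_map_chain _ _ c).
elim: c => [|{h}{}q {}t z j e c IH] /=; first by rewrite comp_lfun1l comp_lfun1r.
rewrite -comp_lfunA -IH !comp_lfunA; congr (_ \o _)%VF; apply/lfunP => x.
rewrite !comp_lfunE !cell_stepE [LHS]linearZ !lfunE /= cellh_Dcell.
by congr (_ *: _); rewrite lfunE.
Qed.

Definition sheaf_hom_of : sheaf_hom (sheaf_of M) (sheaf_of N) :=
  @SheafHom k n X (sheaf_of M) (sheaf_of N)
    (fun p s => linfun (@cellh_res p s)) cellh_res_nat.

End RestrictHom.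

Lemma sheaf_hom_of_id (M : cellular) : sheaf_hom_of (cell_id M) = sheaf_id (sheaf_of M).
Proof.
apply: sheaf_hom_eq => p s; apply/lfunP => x; apply: val_inj.
by rewrite /= !lfunE /= cellh_resE.
Qed.

Lemma sheaf_hom_of_comp (M N P : cellular) (g : cell_hom N P) (f : cell_hom M N) :
  sheaf_hom_of (cell_hcomp g f) = sheaf_comp (sheaf_hom_of g) (sheaf_hom_of f).
Proof.
apply: sheaf_hom_eq => p s; apply/lfunP => x; apply: val_inj.
by rewrite /= comp_lfunE !lfunE /= !cellh_resE.
Qed.

Definition S_functor : functor Cell (Sh k X) :=
  @Functor Cell (Sh k X) sheaf_of sheaf_hom_of sheaf_hom_of_id sheaf_hom_of_comp.

End Cellular.

Section FromSheaf.
Variables (k : fieldType) (n : nat) (X : nsset n).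

Section Module.
Variable F : sheaf k X.

(** F(s <= t), totalized by 0.  It is only used below for simplices [s <= t],
    see [concat_le] and [face_le_face]. *)
Definition sh_res p q (s : X p) (t : X q) : 'Hom(F p s, F q t) :=
  if pselect (face_le s t) is left h then sh_map F h else 0.

Lemma sh_resE p q (s : X p) (t : X q) (h : face_le s t) : sh_res s t = sh_map F h.
Proof.
rewrite /sh_res; case: pselect => // h'.
by rewrite (Prop_irrelevance h h').
Qed.

Lemma sh_res_id p (s : X p) x : sh_res s s x = x.
Proof. by rewrite (sh_resE (face_le_refl s)) sh_map_id lfunE. Qed.

Lemma sh_res_comp p q r (s : X p) (t : X q) (u : X r) x :
  face_le s t -> face_le t u -> sh_res t u (sh_res s t x) = sh_res s u x.
Proof.
move=> st tu; rewrite (sh_resE st) (sh_resE tu) (sh_resE (face_le_trans st tu)).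
by rewrite (sh_map_comp _ st tu) comp_lfunE.
Qed.

Definition total (q : nat) : vectType k := dsum (fun t : X q => F q t).

Definition total_in q (u : X q) (x : F q u) : total q :=
  dsum_in (V := fun t : X q => F q t) x.

HB.instance Definition _ q (u : X q) :=
  GRing.isLinear.Build k (F q u) (total q) *:%R (@total_in q u)
    (@dsum_in_linear k (X q) (fun t => F q t) u).

Definition total_act p q (a : Omega k X p) (m : total q) : total (p + q)%N :=
  \sum_(s : X p) \sum_(t : X q)
    (a : dform k X p) s *:
      (if concat s t is Some u
       then total_in (sh_res t u (dsum_fun m t)) else 0).

Definition total_d q (m : total q) : total q.+1 :=
  \sum_(t : X q) \sum_(i < q.+2) \sum_(z : X q.+1 | face i z == t)
    (-1) ^+ i *: total_in (sh_res t z (dsum_fun m t)).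

Definition push q r (m : total q) (t : X q) (u : X r) : F r u :=
  sh_res t u (dsum_fun m t).

Lemma push_id q (m : total q) (t : X q) : push m t t = dsum_fun m t.
Proof. exact: sh_res_id. Qed.

Lemma push_res q r r' (m : total q) (t : X q) (u : X r) (v : X r') :
  face_le t u -> face_le u v -> sh_res u v (push m t u) = push m t v.
Proof. exact: sh_res_comp. Qed.

Lemma total_actE p q (a : Omega k X p) (m : total q) (u : X (p + q)%N) :
  dsum_fun (total_act a m) u = (a : dform k X p) (front u) *: push m (back u) u.
Proof.
have key (s : X p) (t : X q) :
    dsum_fun ((a : dform k X p) s *: (if concat s t is Some u
       then total_in (sh_res t u (dsum_fun m t)) else 0)) u =
    if (front u == s) && (back u == t) then (a : dform k X p) s *: push m t u else 0.
  rewrite -concatP dsum_scaleE; case: concat => [v|] /=; last first.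
    by rewrite dsum_zeroE scaler0.
  rewrite (inj_eq Some_inj); case: eqP => [<-|/eqP vu].
    by rewrite dsum_in_eq.
  by rewrite dsum_in_neq // scaler0.
rewrite /total_act dsum_sumE (bigD1 (front u)) //= dsum_sumE (bigD1 (back u)) //=.
rewrite key !eqxx /= !big1 ?addr0 // => [s /negbTE su|t /negbTE tu].
  by rewrite dsum_sumE big1 // => t _; rewrite key eq_sym su.
by rewrite key [back u == t]eq_sym tu andbF.
Qed.

Lemma total_dE q (m : total q) (z : X q.+1) :
  dsum_fun (total_d m) z = \sum_(i < q.+2) (-1) ^+ i *: push m (face i z) z.
Proof.
have key (t : X q) (i : 'I_q.+2) :
    dsum_fun (\sum_(z : X q.+1 | face i z == t)
      (-1) ^+ i *: total_in (sh_res t z (dsum_fun m t))) z =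
    if face i z == t then (-1) ^+ i *: push m t z else 0.
  rewrite dsum_sumE big_mkcond (bigD1 z) //= dsum_scaleE dsum_in_eq big1 ?addr0 //.
  by move=> z' z'z; rewrite dsum_scaleE dsum_in_neq // scaler0; case: ifP.
rewrite /total_d dsum_sumE.
under eq_bigr do rewrite dsum_sumE.
rewrite exchange_big; apply: eq_bigr => i _.
rewrite (bigD1 (face i z)) //= key eqxx big1 ?addr0 // => t tz.
by rewrite key eq_sym (negbTE tz).
Qed.

Lemma push_gcast q q' (e : q = q') (m : total q) r (t : X q') (u : X r) :
  push (gcast (V := fun q => total q : lmodType k) e m) t u =
  push m (xcast (esym e) t) u.
Proof. by subst q'. Qed.

Lemma total_act_linearl p q (m : total q) :
  linear (fun a : Omega k X p => total_act a m : total (p + q)%N).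
Proof.
move=> c x y; apply: dsumP => u; rewrite dsum_addE dsum_scaleE !total_actE !ffunE.
by rewrite scalerDl scalerA.
Qed.

Lemma pushD q r c (x y : total q) (t : X q) (u : X r) :
  push (c *: x + y) t u = c *: push x t u + push y t u.
Proof. by rewrite /push dsum_addE dsum_scaleE linearP. Qed.

Lemma total_act_linearr p q (a : Omega k X p) :
  linear (fun m : total q => total_act a m : total (p + q)%N).
Proof.
move=> c x y; apply: dsumP => u; rewrite dsum_addE dsum_scaleE !total_actE.
by rewrite pushD scalerDr !scalerA mulrC.
Qed.

Lemma total_d_linear q : linear (@total_d q).
Proof.
move=> c x y; apply: dsumP => z; rewrite dsum_addE dsum_scaleE !total_dE.
rewrite scaler_sumr -big_split; apply: eq_bigr => i _ /=.
by rewrite pushD scalerDr !scalerA mulrC.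
Qed.

Lemma xcast_le p p' (e : p = p') r (s : X p) (u : X r) :
  face_le (xcast e s) u <-> face_le s u.
Proof. by subst p'. Qed.

Lemma le_xcast p p' (e : p = p') r (s : X p) (u : X r) :
  face_le u (xcast e s) <-> face_le u s.
Proof. by subst p'. Qed.

Lemma push_act p q r (a : Omega k X p) (m : total q) (t : X (p + q)%N) (u : X r) :
  face_le t u ->
  push (total_act a m) t u = (a : dform k X p) (front t) *: push m (back t) u.
Proof.
move=> tu; rewrite {1}/push total_actE linearZ /= push_res //.
exact: face_le_back.
Qed.

Lemma push_d q r (m : total q) (z : X q.+1) (u : X r) :
  face_le z u ->
  push (total_d m) z u = \sum_(i < q.+2) (-1) ^+ i *: push m (face i z) u.
Proof.
move=> zu; rewrite {1}/push total_dE linear_sum; apply: eq_bigr => i _.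
rewrite linearZ /= push_res //; exact: face_le_face.
Qed.

Lemma total_actA p q r (a : Omega k X p) (b : Omega k X q) (x : total r) :
  gcast (V := fun q => total q : lmodType k) (addnA p q r)
    (total_act a (total_act b x)) = total_act (dga_mul a b) x.
Proof.
apply: dsumP => w; rewrite -push_id push_gcast total_actE /= wedgeE.
set w' := xcast _ w.
have w'w : face_le w' w by apply/xcast_le/face_le_refl.
rewrite push_act // push_act; last exact: face_le_trans (face_le_back w') w'w.
by rewrite scalerA /w' front_assoc front_back_assoc back_assoc.
Qed.

Lemma total_act1 q (x : total q) : total_act (dga_one (Omega k X)) x = x.
Proof.
apply: dsumP => u; rewrite (@total_actE 0 q) /=.
by rewrite (unit_formE k (front (u : X (0 + q)%N))) scale1r back0 push_id.
Qed.

Lemma total_dd q (x : total q) : total_d (total_d x) = 0.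
Proof.
apply: dsumP => z; rewrite total_dE dsum_zeroE.
under eq_bigr => i _.
  rewrite (push_d _ (face_le_face i z)) scaler_sumr.
  under eq_bigr do rewrite scalerA.
  over.
apply: sum_lift_antisym => i i' j j' ij ji.
by rewrite (sign_lift k ij ji) (face_face z ij ji) scaleNr.
Qed.

Lemma total_dM p q (a : Omega k X p) (x : total q) :
  total_d (total_act a x) =
  (total_act (dga_d a) x : total (p.+1 + q)%N) +
    (-1) ^+ p *: gcast (V := fun q => total q : lmodType k) (addnS p q)
      (total_act a (total_d x)).
Proof.
apply: dsumP => z; rewrite dsum_addE dsum_scaleE total_dE.
rewrite (@total_actE p.+1 q) /= -[dsum_fun (gcast _ _) z]push_id push_gcast.
set z' := xcast _ z.
have z'z : face_le z' z by apply/xcast_le/face_le_refl.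
rewrite push_act // push_d; last exact: face_le_trans (face_le_back z') z'z.
rewrite form_dE scaler_suml scaler_sumr.
have := @leibniz_sum k (F _ z) p q (fun i => push (total_act a x) (face i z) z)
  (fun i => (a : dform k X p) (face i (front (z : X (p.+1 + q)%N))) *:
             push x (back (z : X (p.+1 + q)%N)) z)
  (fun j => (a : dform k X p) (front z') *: push x (face j (back z')) z).
move=> ->.
- congr (_ + _ *: _); apply: eq_bigr => i _; first by rewrite scalerA.
  by rewrite !scalerA mulrC.
- move=> i c ic ip; rewrite push_act; last exact: face_le_face.
  by rewrite (front_face_low z ic ip) (back_face_low z ip).
- move=> i c ic ip; rewrite push_act; last exact: face_le_face.
  by rewrite (front_face_high z ic ip) (back_face_high z ic ip).
- by rewrite (front_face_mid z) (back_face_mid z).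
Qed.

Definition total_struct : dg_struct (Omega k X) (fun q => total q : lmodType k) :=
  @DGStruct k (Omega k X) (fun q => total q : lmodType k) total_act total_d
    total_act_linearl total_act_linearr total_d_linear total_actA total_act1
    total_dd total_dM.

Definition total_cell q (t : X q) : {vspace total q} :=
  limg (linfun (@total_in q t)).

Lemma total_cellP q (t : X q) (x : total q) :
  reflect (exists y : F q t, x = total_in y)
    (x \in total_cell t).
Proof.
apply: (iffP memv_imgP) => [[y _ ->]|[y ->]]; first by exists y; rewrite lfunE.
by exists y; rewrite ?memvf // lfunE.
Qed.

Lemma total_cell_in q (t : X q) (y : F q t) :
  total_in y \in total_cell t.
Proof. by apply/total_cellP; exists y. Qed.

Lemma total_cell_full q : fullv = (\sum_(t : X q) total_cell t)%VS.
Proof.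
apply/vspaceP => x; rewrite memvf; apply/esym.
rewrite [x]dsum_decomp; apply: memv_sumr => t _; exact: total_cell_in.
Qed.

Lemma total_cell_direct q : directv (\sum_(t : X q) total_cell t)%VS.
Proof.
apply/directv_sum_independent => us uin u0 t _.
have key s r : r != s -> dsum_fun (us r) s = 0.
  by move=> rs; have /total_cellP[y ->] := uin r isT; rewrite dsum_in_neq.
apply: dsumP => s; rewrite dsum_zeroE.
have [<-|/key//] := eqVneq t s.
have := congr1 (fun m => dsum_fun m t) u0.
rewrite /= dsum_sumE dsum_zeroE (bigD1 t) //= big1 ?addr0 // => r; exact: key.
Qed.

Lemma source_front q (u : X (0 + q)%N) : front u = source u.
Proof.
by rewrite /front /source /vertex; congr pull; apply: dinj_eq => i; rewrite ord1;
  apply: val_inj.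
Qed.

Lemma total_cell_source q (t : X q) (x : total q) : x \in total_cell t ->
  exists y : total q, x = total_act (rho k (source t)) y.
Proof.
move=> /total_cellP[y ->]; exists (total_in y).
apply: dsumP => u; rewrite (@total_actE 0 q) back0 source_front ffunE push_id.
have [<-|tu] := eqVneq t u; first by rewrite eqxx scale1r.
by rewrite dsum_in_neq // scaler0.
Qed.

Lemma total_proj q (t : X q) (m : total q) :
  sumv_pi_for (total_cell_full q) t m = total_in (dsum_fun m t).
Proof.
have e : (\sum_s sumv_pi_for (total_cell_full q) s m ==
    \sum_s total_in (dsum_fun m s)).
  by rewrite sumv_pi_sum ?memvf // -[X in _ == X]dsum_decomp.
have h := elimT (@directv_sum_unique k (total q) (X q) xpredT (@total_cell q))
  (total_cell_direct q).
move: e; rewrite h => [/forall_inP/(_ t isT)/eqP//|s _|s _].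
  exact: memv_sum_pi.
exact: total_cell_in.
Qed.

Lemma total_cell_diff q (t : X q) (x : subvs_of (total_cell t)) :
  total_d (vsval x) =
  \sum_(i < q.+2) \sum_(z : X q.+1 | face i z == t)
    vsval (cell_comp total_cell_full total_d z x).
Proof.
have /total_cellP[y xy] := subvsP x.
under eq_bigr do under eq_bigr do
  rewrite /cell_comp /cell_proj vsprojK ?memv_sum_pi // total_proj.
set m := total_d _.
apply: dsumP => z; rewrite [RHS]dsum_sumE -/m.
have key (i : 'I_q.+2) : dsum_fun (\sum_(z : X q.+1 | face i z == t)
    total_in (dsum_fun m z)) z = if face i z == t then dsum_fun m z else 0.
  rewrite dsum_sumE big_mkcond (bigD1 z) //= dsum_in_eq big1 ?addr0 //.
  by move=> z' z'z; rewrite dsum_in_neq //; case: ifP.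
under eq_bigr do rewrite key.
case: (pselect (exists i, face i z = t)) => [[i iz]|no].
  rewrite (bigD1 i) //= iz eqxx big1 ?addr0 // => j ji.
  case: eqP => // jz; case/eqP: ji; apply: (face_inj (z := z)).
  by rewrite jz.
rewrite big1; last by move=> i _; case: eqP => // iz; case: no; exists i.
rewrite /m total_dE big1 // => i _; rewrite xy /push dsum_in_neq ?linear0 ?scaler0 //.
by apply/eqP => e; apply: no; exists i.
Qed.

Definition cellular_of : cellular k X :=
  @Cellular k n X total total_struct total_cell total_cell_full
    total_cell_direct total_cell_source total_cell_diff.

End Module.

Section Morphism.
Variables (F G : sheaf k X) (f : sheaf_hom F G).

Definition total_map q (m : total F q) : total G q :=
  dsum_of (fun t => f q t (dsum_fun m t)).

Lemma total_mapE q (m : total F q) t :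
  dsum_fun (total_map m) t = f q t (dsum_fun m t).
Proof. exact: dsum_ofE. Qed.

Lemma total_map_linear q : linear (@total_map q).
Proof.
move=> c x y; apply: dsumP => t.
by rewrite dsum_addE dsum_scaleE !total_mapE dsum_addE dsum_scaleE linearP.
Qed.

Lemma push_map q r (m : total F q) (t : X q) (u : X r) :
  face_le t u -> push (total_map m) t u = f r u (push m t u).
Proof.
move=> tu; rewrite /push total_mapE !(sh_resE _ tu) -!comp_lfunE.
by rewrite (shh_nat f).
Qed.

Lemma total_map_act p q (a : Omega k X p) (m : total F q) :
  total_map (total_act a m) = total_act a (total_map m).
Proof.
apply: dsumP => u; rewrite total_mapE !total_actE linearZ.
by rewrite push_map //; apply: face_le_back.
Qed.

Lemma total_map_d q (m : total F q) : total_map (total_d m) = total_d (total_map m).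
Proof.
apply: dsumP => u; rewrite total_mapE !total_dE linear_sum.
apply: eq_bigr => i _; rewrite linearZ push_map //; exact: face_le_face.
Qed.

Definition total_hom : dg_hom (cm_dg (cellular_of F)) (cm_dg (cellular_of G)) :=
  @DGHom k (Omega k X) (cm_dg (cellular_of F)) (cm_dg (cellular_of G))
    total_map total_map_linear total_map_act total_map_d.

Lemma total_map_cell q (t : X q) (m : total F q) :
  m \in total_cell F t -> total_map m \in total_cell G t.
Proof.
move=> /total_cellP[y ->]; apply/total_cellP; exists (f q t y).
apply: dsumP => s; rewrite total_mapE.
have [<-|ts] := eqVneq t s; first by rewrite !dsum_in_eq.
by rewrite !dsum_in_neq // linear0.
Qed.

Definition cell_hom_of : cell_hom (cellular_of F) (cellular_of G) :=
  @CellHom k n X (cellular_of F) (cellular_of G) total_hom total_map_cell.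

End Morphism.

Lemma cell_hom_of_id (F : sheaf k X) : cell_hom_of (sheaf_id F) = cell_id (cellular_of F).
Proof.
apply: cell_hom_eq => q x; apply: dsumP => t.
by rewrite [LHS]total_mapE /= lfunE.
Qed.

Lemma cell_hom_of_comp (F G H : sheaf k X) (g : sheaf_hom G H) (f : sheaf_hom F G) :
  cell_hom_of (sheaf_comp g f) = cell_hcomp (cell_hom_of g) (cell_hom_of f).
Proof.
apply: cell_hom_eq => q x; apply: dsumP => t.
by rewrite [LHS]total_mapE [RHS]total_mapE total_mapE /= comp_lfunE.
Qed.

Definition R_functor : functor (Sh k X) (Cell k X) :=
  @Functor (Sh k X) (Cell k X) cellular_of cell_hom_of cell_hom_of_id
    cell_hom_of_comp.

End FromSheaf.

(* Main.v *)
(** For a sheaf [F], [F t] embeds onto the cell of [t] in [M_F], and this is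
    compatible with codimension-one restrictions because the two signs
    [(-1)^i], in the differential of [M_F] and in [F_M], cancel.

    For a cellular module [M], projecting to the cells is a linear bijection
    from [M] to [M_{F_M}] commuting with the differentials.  The point is that
    the action of all forms is determined by the decomposition and the
    differential: if [e = [v, w]] is an edge then
    [rho_e = delta_v (d delta_w) delta_w], so the Leibniz rule gives
    [rho_e m = delta_v d (delta_w m)], whose only contribution comes from the
    face of index 0; and every [rho_s] is a product of edge forms. *)
From HB Require Import structures.
From mathcomp Require Import all_boot all_order all_algebra.
From mathcomp Require Import boolp.
Require Import Defs.
Set Implicit Arguments.
Unset Strict Implicit.
Unset Printing Implicit Defensive.
Import GRing.Theory.
Local Open Scope ring_scope.

(** Naturality of the inverse family: insert $f_a g_a=\mathrm{id}$ on the right, use naturality of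
    $f$, cancel $g_b f_b$. Both isomorphisms below start from an identity functor, opposite to the
    direction in [define_equivalence]. *)
Lemma nat_iso_sym (C D : category) (F G : functor C D) :
  nat_iso F G -> nat_iso G F.
Proof.
case: D F G => D hm i c idl idr assoc F G [f g gf fg nat].
exists g f => // a b h; rewrite /= in f g gf fg nat *.
by rewrite -[LHS]idr -fg [LHS]assoc -[c _ _ _ (c _ _ _ (g b) _) (f a)]assoc -nat
  assoc gf idl.
Qed.

(** * The isomorphism $F\cong F_{M_F}$ of sheaves *)

Section SheafUnit.
Variables (k : fieldType) (n : nat) (X : nsset n).

Section Component.
Variable F : sheaf k X.

Definition unit_cell q (t : X q) (y : F q t) : subvs_of (total_cell F t) :=
  vsproj (total_cell F t) (total_in y).

Lemma unit_cellE q (t : X q) (y : F q t) : vsval (unit_cell y) = total_in y.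
Proof. exact: vsprojK (total_cell_in y). Qed.

Lemma unit_cell_linear q (t : X q) : linear (@unit_cell q t).
Proof. by move=> c x y; rewrite /unit_cell !linearP. Qed.

HB.instance Definition _ q (t : X q) :=
  GRing.isLinear.Build k (F q t) (subvs_of (total_cell F t)) *:%R
    (@unit_cell q t) (@unit_cell_linear q t).

Definition counit_cell q (t : X q) (x : subvs_of (total_cell F t)) : F q t :=
  dsum_fun (vsval x) t.

Lemma counit_cell_linear q (t : X q) : linear (@counit_cell q t).
Proof. by move=> c x y; rewrite /counit_cell linearP dsum_addE dsum_scaleE. Qed.

HB.instance Definition _ q (t : X q) :=
  GRing.isLinear.Build k (subvs_of (total_cell F t)) (F q t) *:%R
    (@counit_cell q t) (@counit_cell_linear q t).

Lemma unit_cellK q (t : X q) : cancel (@unit_cell q t) (@counit_cell q t).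
Proof. by move=> y; rewrite /counit_cell unit_cellE dsum_in_eq. Qed.

(** Elements of [total_cell F t] are supported at [t], so evaluation there loses nothing. *)
Lemma counit_cellK q (t : X q) : cancel (@counit_cell q t) (@unit_cell q t).
Proof.
move=> x; apply: val_inj; rewrite -[LHS]/(vsval _) unit_cellE.
have /total_cellP[y xy] := subvsP x.
by rewrite /counit_cell xy dsum_in_eq.
Qed.

Lemma cproj_total q (t : X q) (m : total F q) :
  cproj (M := cellular_of F) t m = unit_cell (dsum_fun m t).
Proof.
by apply: val_inj; rewrite -[LHS]/(vsval _) -[RHS]/(vsval _) cprojE unit_cellE
  total_proj.
Qed.

Lemma cell_step_unit q (z : X q.+1) (i : 'I_q.+2) (y : F q (face i z)) :
  cell_step (cellular_of F) (face i z) z i (unit_cell y) =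
  unit_cell (sh_res F (face i z) z y).
Proof.
(* The faces of [z] are pairwise distinct, so an element supported at [face i z] meets only the term
   of index [i]. *)
rewrite cell_stepE DcellE cproj_total unit_cellE total_dE (bigD1 i) //= big1.
  by rewrite addr0 /push dsum_in_eq linearZ scalerA -exprMn mulrNN mulr1
    expr1n scale1r.
move=> j ji; rewrite /push dsum_in_neq ?linear0 ?scaler0 //.
by apply: contraNneq ji => /face_inj ->.
Qed.

(** [sheaf_map] may be computed along any chain, so induction on a chain reduces the square to
    codimension one, which is [cell_step_unit]. *)
Lemma unit_cell_nat p q (s : X p) (t : X q) (h : face_le s t) :
  (linfun (@unit_cell q t) \o sh_map F h =
   sheaf_map (cellular_of F) h \o linfun (@unit_cell p s))%VF.
Proof.
case: (h) => c; rewrite (sheaf_map_chain _ _ c).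
elim: c h => [|{}q {}t z j e c IH] h.
  by rewrite sh_map_id /= comp_lfun1r comp_lfun1l.
subst t; have st : face_le s (face j z) by constructor.
have tz := face_le_face j z.
rewrite (sh_map_comp F st tz) /= -[RHS]comp_lfunA -(IH st).
apply/lfunP => y; rewrite !comp_lfunE [LHS]lfunE.
rewrite (_ : linfun _ (sh_map F _ y) = unit_cell (sh_map F st y)).
  by rewrite [RHS]cell_step_unit (sh_resE F tz).
by rewrite lfunE (Prop_irrelevance st (inhabits c)).
Qed.

Definition unit_hom : sheaf_hom F (sheaf_of (cellular_of F)) :=
  @SheafHom k n X F (sheaf_of (cellular_of F))
    (fun p s => linfun (@unit_cell p s)) unit_cell_nat.

Lemma counit_cell_nat p q (s : X p) (t : X q) (h : face_le s t) :
  (linfun (@counit_cell q t) \o sheaf_map (cellular_of F) h =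
   sh_map F h \o linfun (@counit_cell p s))%VF.
Proof.
apply/lfunP => x; rewrite -[x]counit_cellK !comp_lfunE.
have := congr1 (fun f : 'Hom(_, _) => f (counit_cell x)) (unit_cell_nat h).
by rewrite !comp_lfunE !lfunE /= => <-; rewrite !unit_cellK.
Qed.

Definition counit_hom : sheaf_hom (sheaf_of (cellular_of F)) F :=
  @SheafHom k n X (sheaf_of (cellular_of F)) F
    (fun p s => linfun (@counit_cell p s)) counit_cell_nat.

End Component.

Lemma unit_cell_hom (F G : sheaf k X) (f : sheaf_hom F G) q (t : X q)
    (y : F q t) :
  cellh_res (cell_hom_of f) (unit_cell y) = unit_cell (f q t y).
Proof.
apply: val_inj; rewrite -[LHS]/(vsval _) -[RHS]/(vsval _).
rewrite cellh_resE !unit_cellE; apply: dsumP => s; rewrite [LHS]total_mapE.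
have [<-|ts] := eqVneq t s; first by rewrite !dsum_in_eq.
by rewrite !dsum_in_neq // linear0.
Qed.

Lemma sheaf_unit_iso :
  nat_iso (functor_id (Sh k X)) (functor_comp (S_functor k X) (R_functor k X)).
Proof.
exists unit_hom counit_hom => [F|F|F G f]; apply: sheaf_hom_eq => p s;
  apply/lfunP => x; rewrite /= !comp_lfunE !lfunE /=.
- exact: unit_cellK.
- exact: counit_cellK.
rewrite -unit_cell_hom; apply/esym. exact: (lfunE (@cellh_res k n X _ _ (cell_hom_of f) p s) (unit_cell x)).
Qed.

End SheafUnit.

(** The action and the differential are bare functions with a separate linearity proof; this makes
    [linear_sum] available for them. *)
Lemma linear_bigsum (R : pzRingType) (U V : lmodType R) (f : U -> V)
    (I : Type) (r : seq I) (P : pred I) (F : I -> U) :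
  linear f -> f (\sum_(i <- r | P i) F i) = \sum_(i <- r | P i) f (F i).
Proof.
move=> fl.
pose g : {linear U -> V} := HB.pack f (GRing.isLinear.Build _ _ _ _ _ fl).
exact: (linear_sum g).
Qed.

Lemma linear_scaled (R : pzRingType) (U V : lmodType R) (f : U -> V) c x :
  linear f -> f (c *: x) = c *: f x.
Proof.
move=> fl.
pose g : {linear U -> V} := HB.pack f (GRing.isLinear.Build _ _ _ _ _ fl).
exact: (linearZ_LR g c x).
Qed.

(** When the leading form has degree 0 or 1, both degrees in the module laws are convertible and the
    cast is along a loop. *)
Lemma gcast_id (R : pzRingType) (V : nat -> lmodType R) p (e : p = p) (x : V p) :
  gcast e x = x.
Proof. by rewrite (Prop_irrelevance e erefl). Qed.

(** * Basis forms as products of vertex and edge forms *)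

Section CellCounit.
Variables (k : fieldType) (n : nat) (X : nsset n).

(** By [concatP], a simplex is the concatenation of its front and back, and concatenation is
    single-valued. *)
Lemma eq_cut p q (u v : X (p + q)%N) :
  (u == v) = (front u == front v) && (back u == back v).
Proof.
have /eqP e : concat (front v) (back v) == Some v by rewrite concatP !eqxx.
by rewrite -concatP e (inj_eq Some_inj) eq_sym.
Qed.

Lemma rho_cut p q (u : X (p + q)%N) :
  rho k u = wedge (rho k (front u)) (rho k (back u)).
Proof.
by apply/ffunP => v; rewrite wedgeE !ffunE -natrM mulnb -eq_cut.
Qed.

Lemma face_edge0 (e : X 1%N) : face ord0 e = target e.
Proof.
by congr pull; apply: dinj_eq => i; apply: val_inj; rewrite /= ord1.
Qed.

Lemma face_edge1 (e : X 1%N) : face ord_max e = source e.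
Proof.
by congr pull; apply: dinj_eq => i; apply: val_inj; rewrite /= ord1.
Qed.

Lemma source_neq_target (e : X 1%N) : source e != target e.
Proof. by apply/eqP => /vertex_inj. Qed.

Lemma edge_eq (e e' : X 1%N) :
  source e = source e' -> target e = target e' -> e = e'.
Proof.
move=> es et; apply: vertices_eqP => i.
case: (unliftP ord0 i) => [j ->|->//]; rewrite ord1.
by rewrite (_ : lift _ _ = ord_max) //; apply: val_inj.
Qed.

Lemma form_split p (a : dform k X p) : a = \sum_s a s *: rho k s.
Proof.
apply/ffunP => u; rewrite sum_ffun1 (bigD1 u) //= !ffunE eqxx big1.
  by rewrite addr0 /GRing.scale /= mulr1.
by move=> s su; rewrite !ffunE eq_sym (negbTE su) scaler0.
Qed.

Lemma rho_vertex_mul (v w : X 0%N) :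
  wedge (rho k v) (rho k w) = (v == w)%:R *: rho k v.
Proof.
apply/ffunP => u; rewrite (@wedgeE k n X 0 0) !ffunE.
rewrite back0 (@face_le_eq n X 0 (front u) u); last by apply/face_leP; eexists.
case: (eqVneq u v) => [->|_]; last by rewrite mul0r scaler0.
by rewrite mul1r /GRing.scale /= mulr1.
Qed.

(** For $e=[v,w]$ and $u=[a,b]$ the right side at $u$ is
    $\delta_v(a)(\delta_w(b)-\delta_w(a))\delta_w(b)$. The outer factors force $u=e$, where the
    middle one is 1 because $v\ne w$. *)
Lemma rho_edge (e : X 1%N) :
  rho k e = wedge (wedge (rho k (source e)) (form_d (rho k (target e))))
              (rho k (target e)) :> dform k X 1.
Proof.
apply/ffunP => u; rewrite (@wedgeE k n X 1 0) (@wedgeE k n X 0 1).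
rewrite (@face_le_eq n X 1 (@front n X 1 0 u) u); last first.
  by apply/face_leP; eexists.
rewrite back0 source_front form_dE big_ord_recl big_ord1 /=.
have -> : lift ord0 ord0 = ord_max :> 'I_2 by apply: val_inj.
have -> : @back n X 1 0 u = target u.
  by congr pull; apply: dinj_eq => i; apply: val_inj; rewrite /= ord1.
rewrite face_edge0 face_edge1 !ffunE.
have [->|ue] := eqVneq u e.
  by rewrite !eqxx (negbTE (source_neq_target e)) mulr0 addr0 !mulr1.
case: eqVneq => us; last by rewrite !mul0r.
case: eqVneq => ut; last by rewrite mulr0.
by case/eqP: ue; apply: edge_eq.
Qed.

(** * The action and the differential of a cellular module, read off its cells *)

Variable M : cellular k X.

Lemma act_vertex_vertex q (v w : X 0%N) (x : M q) :
  act (cm_struct M) (rho k v) (act (cm_struct M) (rho k w) x) =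
  (v == w)%:R *: act (cm_struct M) (rho k v) x :> M q.
Proof.
have := actA (cm_struct M) (rho k v) (rho k w) x.
rewrite (gcast_id (V := fun q => M q : lmodType k)) => ->.
rewrite [dga_mul _ _]rho_vertex_mul.
by rewrite (linear_scaled _ _ (act_linearl (cm_struct M) x)).
Qed.

(** By [cell_source] the element has the form $\delta_{s(t)}y$, and vertex forms act as orthogonal
    idempotents. *)
Lemma act_vertex_cell q (v : X 0%N) (t : X q) (x : subvs_of (cell M t)) :
  act (cm_struct M) (rho k v) (vsval x) =
  (v == source t)%:R *: vsval x :> M q.
Proof.
have [y ->] := cell_source (subvsP x).
rewrite act_vertex_vertex.
by case: eqVneq => [->|_] //; rewrite !scale0r.
Qed.

Lemma cproj_act_vertex q (v : X 0%N) (t : X q) (x : M q) :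
  cproj t (act (cm_struct M) (rho k v) x : M q) = (v == source t)%:R *: cproj t x.
Proof.
rewrite -{1}(cproj_sum x).
rewrite (linear_bigsum _ _ _ (act_linearr (cm_struct M) (rho k v))) linear_sum.
rewrite (bigD1 t) //= big1 => [|s st]; rewrite act_vertex_cell linearZ /=.
  by rewrite addr0 cprojK.
by rewrite cproj_neq // scaler0.
Qed.

Lemma sh_res_face q (z : X q.+1) (i : 'I_q.+2) :
  sh_res (sheaf_of M) (face i z) z = cell_step M (face i z) z i.
Proof.
rewrite (sh_resE _ (face_le_face i z)).
have := sheaf_map_chain M (face_le_face i z) (FaceChainStep i erefl FaceChainNil).
by rewrite /= comp_lfun1r.
Qed.

(** The right side is the differential of $M_{F_M}$: the sign inside [cell_step] cancels the
    explicit one, and components of $d_M$ between non-incident cells vanish. *)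
Lemma cproj_diff q (z : X q.+1) (x : M q) :
  cproj z (diff (cm_struct M) x) =
  \sum_(i < q.+2) (-1) ^+ i *:
    sh_res (sheaf_of M) (face i z) z (cproj (face i z) x).
Proof.
have dl := @diff_linear _ _ _ (cm_struct M) q.
under [RHS]eq_bigr do rewrite sh_res_face cell_stepE scalerA -exprMn mulrNN
  mulr1 expr1n scale1r.
rewrite -{1}(cproj_sum x) (linear_bigsum _ _ _ dl) linear_sum /=.
(* Indices are grouped by the face they produce; [face_inj] leaves at most one index for each
   [t]. *)
rewrite [RHS](partition_big (fun i => face i z) xpredT) //=.
apply: eq_bigr => t _; rewrite -DcellE.
have [[i it]|no] := pselect (exists i, face i z = t).
  subst t; rewrite (bigD1 i) //= big1 ?addr0 // => j /andP[/eqP ji].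
  by move/eqP; case; apply: face_inj ji.
rewrite Dcell0 => [|i]; last by apply/eqP => it; apply: no; exists i.
by rewrite big1 // => i /eqP it; case: no; exists i.
Qed.

Lemma act_edge (e : X 1%N) q (x : M q) :
  act (cm_struct M) (rho k e) x =
  act (cm_struct M) (rho k (source e))
    (diff (cm_struct M) (act (cm_struct M) (rho k (target e)) x)) :> M q.+1.
Proof.
set v := source e; set w := target e; set S := cm_struct M.
rewrite rho_edge -/v -/w.
have gV p (r : p = p) (y : M p) := gcast_id (V := fun q => M q : lmodType k) r y.
have := actA S (wedge (rho k v) (form_d (rho k w))) (rho k w) x.
rewrite gV => E1; rewrite -[LHS]E1 {E1}; set y := act S (rho k w) x : M q.
have := actA S (rho k v) (form_d (rho k w)) y.
rewrite gV => E2; rewrite -[LHS]E2 {E2}.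
(* Since $y=\delta_w x$ satisfies $\delta_w y=y$, the Leibniz rule reads
   $dy=(d\delta_w)y+\delta_w\,dy$; applying $\delta_v$ will kill the last term, as $v\ne w$. *)
have := diff_act S (rho k w) y; rewrite expr0 scale1r gV.
rewrite [act S (rho k w) y]act_vertex_vertex eqxx scale1r => dwy.
have := act_linearr S (rho k v) 1 (act S (dga_d (rho k w : Omega k X 0)) y)
  (act S (rho k w) (diff S y)).
rewrite !scale1r -dwy => ->.
rewrite [X in _ = _ + X]act_vertex_vertex (negbTE (source_neq_target e)).
by rewrite scale0r addr0.
Qed.

Lemma source_face q (u : X q.+1) (i : 'I_q.+2) :
  (0 < i)%N -> source (face i u) = source u.
Proof.
move=> i0; rewrite /source /face vertex_pull; congr (vertex u _).
by apply: val_inj; rewrite /= /bump leqNgt i0.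
Qed.

Lemma cproj_act_edge (e : X 1%N) q (u : X q.+1) (x : M q) :
  cproj u (act (cm_struct M) (rho k e) x : M q.+1) =
  (@front n X 1 q u == e)%:R *:
    sh_res (sheaf_of M) (@back n X 1 q u) u (cproj (@back n X 1 q u) x).
Proof.
rewrite act_edge cproj_act_vertex cproj_diff.
have sfront : source (@front n X 1 q u) = source u.
  rewrite /source vertex_pull; congr (vertex u _); exact: val_inj.
have tfront : target (@front n X 1 q u) = source (face ord0 u).
  rewrite /source /target !vertex_pull; congr (vertex u _); exact: val_inj.
have -> : @back n X 1 q u = face ord0 u.
  by congr pull; apply: dinj_eq => i; apply: val_inj.
have [fe|fe] := eqVneq (@front n X 1 q u) e.
  rewrite -fe sfront eqxx scale1r big_ord_recl big1 ?addr0.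
    by rewrite cproj_act_vertex tfront eqxx !scale1r.
  (* A face of positive index keeps the source of [e], so the indicator of the target of [e]
     annihilates its component. *)
  move=> i _; rewrite cproj_act_vertex source_face //.
  rewrite -sfront eq_sym (negbTE (source_neq_target _)).
  by rewrite scale0r linear0 scaler0.
(* Now [front u] differs from [e]. If the sources agree, a surviving term must have index 0, and
   then the targets agree too, against [edge_eq]. *)
rewrite scale0r; case: eqVneq => [se|_]; last by rewrite scale0r.
rewrite scale1r big1 // => i _; rewrite cproj_act_vertex.
case: eqVneq => [te|_]; last by rewrite scale0r linear0 scaler0.
case: (posnP i) => [i0|i0]; last first.
  by have := source_neq_target e; rewrite se te source_face // eqxx.
case/eqP: fe; apply: edge_eq; rewrite ?sfront ?se // te tfront.
by congr (source (face _ u)); apply: val_inj.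
Qed.

(** Induction on [p]: [rho_cut] splits off the first edge, the remaining simplex acts first, and the
    two restrictions compose by functoriality. *)
Lemma cproj_act_rho p (s : X p) q (x : M q) (u : X (p + q)%N) :
  cproj u (act (cm_struct M) (rho k s) x : M (p + q)%N) =
  (front u == s)%:R *: sh_res (sheaf_of M) (back u) u (cproj (back u) x).
Proof.
elim: p s u => [|p IH] s u.
  by rewrite cproj_act_vertex back0 source_front sh_res_id eq_sym.
rewrite (@rho_cut 1 p s).
have := actA (cm_struct M) (rho k (@front n X 1 p s)) (rho k (@back n X 1 p s)) x.
rewrite (gcast_id (V := fun q => M q : lmodType k)) => E.
rewrite -[X in cproj u X]E {E}.
rewrite (@cproj_act_edge _ (p + q)%N u) IH linearZ /= scalerA.
have le1 := @face_le_back n X 1 (p + q) u.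
have le2 := face_le_back (@back n X 1 (p + q) u).
rewrite [X in _ *: X = _](@sh_res_comp k n X (sheaf_of M) _ _ _ _ _ _ (cproj _ x) le2 le1).
rewrite (@eq_cut 1 p) -natrM mulnb.
(* Iterated fronts and backs are pullbacks, so it suffices to compare the underlying injections. *)
have -> : back (@back n X 1 (p + q) u) = @back n X p.+1 q u.
  by rewrite /back -pull_comp; congr pull; apply: dinj_eq => i; apply: val_inj.
have -> : @front n X 1 p (@front n X p.+1 q u) = @front n X 1 (p + q) u.
  by rewrite /front -pull_comp; congr pull; apply: dinj_eq => i; apply: val_inj.
have -> // : @back n X 1 p (@front n X p.+1 q u) = front (@back n X 1 (p + q) u).
by rewrite /front /back -!pull_comp; congr pull; apply: dinj_eq => i;
  apply: val_inj.
Qed.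

Lemma cproj_act p q (a : Omega k X p) (x : M q) (u : X (p + q)%N) :
  cproj u (act (cm_struct M) a x : M (p + q)%N) =
  (a : dform k X p) (front u) *:
    sh_res (sheaf_of M) (back u) u (cproj (back u) x).
Proof.
have al := act_linearl (cm_struct M) (p := p) x.
rewrite [a]form_split (linear_bigsum _ _ _ al) linear_sum.
rewrite sum_ffun1 scaler_suml; apply: eq_bigr => s _.
rewrite (linear_scaled _ _ al) linearZ ffunE -scalerA ffunE; congr (_ *: _).
exact: cproj_act_rho.
Qed.

(** * The isomorphism $M\cong M_{F_M}$ of cellular modules *)

Definition spread q (x : M q) : total (sheaf_of M) q :=
  dsum_of (V := fun t : X q => sheaf_of M q t) (fun t => cproj t x).

Lemma spreadE q (x : M q) (t : X q) : dsum_fun (spread x) t = cproj t x.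
Proof. exact: dsum_ofE. Qed.

Lemma spread_linear q : linear (@spread q).
Proof.
move=> c x y; apply: dsumP => t.
by rewrite dsum_addE dsum_scaleE !spreadE linearP.
Qed.

Lemma spread_act p q (a : Omega k X p) (x : M q) :
  spread (act (cm_struct M) a x : M (p + q)%N) = total_act a (spread x).
Proof. by apply: dsumP => u; rewrite total_actE spreadE cproj_act /push spreadE. Qed.

Lemma spread_d q (x : M q) :
  spread (diff (cm_struct M) x) = total_d (spread x).
Proof.
apply: dsumP => z; rewrite total_dE spreadE cproj_diff.
by apply: eq_bigr => i _; rewrite /push spreadE.
Qed.

Lemma spread_cell q (t : X q) (x : M q) :
  x \in cell M t -> spread x \in total_cell (sheaf_of M) t.
Proof.
move=> xt; apply/total_cellP; exists (cproj t x); apply: dsumP => s.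
rewrite spreadE -(vsprojK xt).
have [<-|ts] := eqVneq t s; first by rewrite dsum_in_eq.
by rewrite dsum_in_neq // cproj_neq.
Qed.

Definition spread_hom : cell_hom M (cellular_of (sheaf_of M)) :=
  @CellHom k n X M (cellular_of (sheaf_of M))
    (@DGHom k (Omega k X) (cm_dg M) (cm_dg (cellular_of (sheaf_of M)))
      spread spread_linear spread_act spread_d) spread_cell.

Definition gather q (m : total (sheaf_of M) q) : M q :=
  \sum_(t : X q) vsval (dsum_fun m t : subvs_of (cell M t)).

Lemma spreadK q : cancel (@spread q) (@gather q).
Proof.
move=> x; rewrite /gather; under eq_bigr do rewrite spreadE.
exact: cproj_sum.
Qed.

(** The sum of the cells is direct, so a decomposition into cell components is unique. *)
Lemma gatherK q : cancel (@gather q) (@spread q).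
Proof.
move=> m; apply: dsumP => t; rewrite spreadE.
apply: (cell_sum_inj (f := fun s => cproj s _)); exact: cproj_sum.
Qed.

(** Here and in the next two lemmas, [gather] inherits its compatibility from [spread], which is
    injective by [spreadK]. *)
Lemma gather_linear q : linear (@gather q).
Proof.
by move=> c x y; apply: (can_inj (@spreadK q)); rewrite spread_linear !gatherK.
Qed.

Lemma gather_act p q (a : Omega k X p) (m : total (sheaf_of M) q) :
  gather (total_act a m) = act (cm_struct M) a (gather m) :> M (p + q)%N.
Proof. by apply: (can_inj (@spreadK _)); rewrite spread_act !gatherK. Qed.

Lemma gather_d q (m : total (sheaf_of M) q) :
  gather (total_d m) = diff (cm_struct M) (gather m).
Proof. by apply: (can_inj (@spreadK _)); rewrite spread_d !gatherK. Qed.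

Lemma gather_cell q (t : X q) (m : total (sheaf_of M) q) :
  m \in total_cell (sheaf_of M) t -> gather m \in cell M t.
Proof.
move=> /total_cellP[y ->]; rewrite /gather (bigD1 t) //= dsum_in_eq.
rewrite big1 => [|s st]; last by rewrite dsum_in_neq // eq_sym.
by rewrite addr0; apply: subvsP.
Qed.

Definition gather_hom : cell_hom (cellular_of (sheaf_of M)) M :=
  @CellHom k n X (cellular_of (sheaf_of M)) M
    (@DGHom k (Omega k X) (cm_dg (cellular_of (sheaf_of M))) (cm_dg M)
      gather gather_linear gather_act gather_d) gather_cell.

End CellCounit.

(** Cellular morphisms commute with the projections to cells. *)
Lemma spread_nat (k : fieldType) (n : nat) (X : nsset n) (M N : cellular k X)
    (f : cell_hom M N) q (x : M q) :
  spread (f q x) = total_map (sheaf_hom_of f) (spread x).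
Proof.
apply: dsumP => t; rewrite total_mapE !spreadE cellh_cproj.
by apply/esym; exact: (lfunE (@cellh_res k n X _ _ f q t) (cproj t x)).
Qed.

Lemma cell_counit_iso (k : fieldType) (n : nat) (X : nsset n) :
  nat_iso (functor_id (Cell k X))
    (functor_comp (R_functor k X) (S_functor k X)).
Proof.
exists (@spread_hom k n X) (@gather_hom k n X) => [M|M|M N f];
  apply: cell_hom_eq => q x.
- exact: spreadK.
- exact: gatherK.
exact: spread_nat.
Qed.

Theorem theorem2 (k : fieldType) (hk : 2%N \notin [pchar k])
    (n : nat) (X : nsset n) :
  define_equivalence (R_functor k X) (S_functor k X).
Proof.
by split; constructor; apply: nat_iso_sym;
  [exact: sheaf_unit_iso | exact: cell_counit_iso].
Qed.
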